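(* Consider two signal detection models $\boldsymbol\theta_1,\boldsymbol\theta_2$ with common noise distributions as described in the context. Suppose that for $j\in\{1,2\}$ there is $\sigma_j>0$ with $$T_n(\boldsymbol\theta_j)\overset{d}{\longrightarrow}N(-\sigma_j^2/2,\sigma_j^2)\ \text{under }P_{(n)},\qquad T_n(\boldsymbol\theta_j)\overset{d}{\longrightarrow}N(\sigma_j^2/2,\sigma_j^2)\ \text{under }Q_{(n)}(\boldsymbol\theta_j).$$ Assume that for $j,r\in\{1,2\}$ the limit $$\gamma(\boldsymbol\theta_j,\boldsymbol\theta_r)=\lim_{n\to\infty}\sum_{i=1}^{k_n}\varepsilon_{n,i}^{(j)}\varepsilon_{n,i}^{(r)}\,\mathrm{Cov}_{P_{n,i}}\Bigl(\frac{d\mu_{n,i}^{(j)}}{dP_{n,i}},\frac{d\mu_{n,i}^{(r)}}{dP_{n,i}}\Bigr)$$ exists in $\mathbb R$ (in particular the covariances are well defined and finite), and that $\gamma(\boldsymbol\theta_j,\boldsymbol\theta_j)=\sigma_j^2$ for $j=1,2$. Let $\alpha\in(0,1)$ and let the critical values $c_{n,j}$ be chosen such that the tests $\varphi_n(\boldsymbol\theta_j)=\mathbf 1\{T_n(\boldsymbol\theta_j)>c_{n,j}\}$ satisfy $E_{P_{(n)}}(\varphi_n(\boldsymbol\theta_j))\to\alpha$ for $j=1,2$. Then $$E_{Q_{(n)}(\boldsymbol\theta_1)}(\varphi_n(\boldsymbol\theta_2))\to\Phi\Bigl(\frac{\gamma(\boldsymbol\theta_1,\boldsymbol\theta_2)}{\sqrt{\gamma(\boldsymbol\theta_2,\boldsymbol\theta_2)}}+u_\alpha\Bigr)=\Phi\Bigl(\mathrm{sign}(\gamma(\boldsymbol\theta_1,\boldsymbol\theta_2))\sqrt{\gamma(\boldsymbol\theta_1,\boldsymbol\theta_1)\,\mathrm{ARE}}+u_\alpha\Bigr),$$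 where $$\mathrm{ARE}=\frac{\gamma(\boldsymbol\theta_1,\boldsymbol\theta_2)^2}{\gamma(\boldsymbol\theta_1,\boldsymbol\theta_1)\,\gamma(\boldsymbol\theta_2,\boldsymbol\theta_2)}\in[0,1].$$
   Context: $k_n\in\mathbb N$, $k_n\to\infty$. For each $n$ and $1\le i\le k_n$, $P_{n,i}$ is a probability measure (noise). For $j=1,2$ the model $\boldsymbol\theta_j=(\boldsymbol\mu^{(j)},\boldsymbol\varepsilon^{(j)})$ consists of probability measures $\mu_{n,i}^{(j)}\ll P_{n,i}$ and numbers $\varepsilon_{n,i}^{(j)}\in[0,1]$, $1\le i\le k_n$, with $\max_{1\le i\le k_n}\varepsilon_{n,i}^{(j)}\to0$. Put $P_{(n)}=\bigotimes_{i=1}^{k_n}P_{n,i}$, $Q_{n,i}(\boldsymbol\theta_j)=(1-\varepsilon_{n,i}^{(j)})P_{n,i}+\varepsilon_{n,i}^{(j)}\mu_{n,i}^{(j)}$, $Q_{(n)}(\boldsymbol\theta_j)=\bigotimes_{i=1}^{k_n}Q_{n,i}(\boldsymbol\theta_j)$, and $T_n(\boldsymbol\theta_j)=\sum_{i=1}^{k_n}\log\frac{dQ_{n,i}(\boldsymbol\theta_j)}{dP_{n,i}}(Y_{n,i})$, where $Y_{n,i}$ are the coordinates. $\Phi$ is the standard normal distribution function and $u_\alpha$ its $\alpha$-quantile, $\Phi(u_\alpha)=\alpha$; $\mathrm{sign}(0)=0$. *)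

(* Defs.v *)
From HB Require Import structures.
From mathcomp Require Import all_boot all_order all_algebra.
From mathcomp Require Import interval_inference.
From mathcomp Require Import all_classical all_reals all_analysis.

Set Implicit Arguments.
Unset Strict Implicit.
Unset Printing Implicit Defensive.

Import Order.TTheory GRing.Theory Num.Theory.
Import numFieldNormedType.Exports.

Local Open Scope classical_set_scope.
Local Open Scope ring_scope.
Local Open Scope charge_scope.

Definition cylinders (I : Type) (d : I -> measure_display)
    (X : forall i, measurableType (d i)) : set (set (forall i, X i)) :=
  [set C | exists i (B : set (X i)),
     measurable B /\ C = [set y | B (y i)]].

Arguments cylinders {I d} X.

Notation product_space X := (g_sigma_algebraType (cylinders X)).

Section product_space.
Context (I : Type) (d : I -> measure_display)
  (X : forall i, measurableType (d i)).

Lemma measurable_coord i :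
  measurable_fun [set: product_space X] (fun y : product_space X => y i).
Proof.
move=> _ B mB; rewrite setTI; apply: sub_sigma_algebra.
by exists i, B.
Qed.

Lemma measurable_fun_product d' (T : measurableType d')
    (f : T -> product_space X) :
  (forall i, measurable_fun [set: T] (fun t => f t i)) ->
  measurable_fun [set: T] f.
Proof.
move=> mf; apply: (@measurability _ _ _ _ setT f (cylinders X)) => //.
move=> _ [C [i [B [mB ->]]] <-].
exact: mf.
Qed.

End product_space.
Arguments measurable_coord {I d} X i.

Section dependent_cons.
Context n (X : 'I_n.+1 -> Type).

Definition dcons (x : X ord0) (y : forall i, X (lift ord0 i)) i : X i :=
  match unliftP ord0 i with
  | UnliftSome j e => ecast k (X k) (esym e) (y j)
  | UnliftNone e => ecast k (X k) (esym e) x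
  end.

Lemma dcons0 x y : dcons x y ord0 = x.
Proof.
rewrite /dcons; case: unliftP => [j e|e].
  by exfalso; move: (neq_lift ord0 j); rewrite -e eqxx.
by rewrite (eq_irrelevance (esym e) erefl).
Qed.

Lemma dcons_lift x y j : dcons x y (lift ord0 j) = y j.
Proof.
rewrite /dcons; case: unliftP => [k e|e]; last first.
  by exfalso; move: (neq_lift ord0 j); rewrite e eqxx.
have ejk := lift_inj e; subst k.
by rewrite (eq_irrelevance (esym e) erefl).
Qed.

End dependent_cons.

Section product_probability.
Context (R : realType).

Lemma product_probability_exists n (d : 'I_n -> measure_display)
    (X : forall i, measurableType (d i)) (P : forall i, probability (X i) R) :
  exists Q : probability (product_space X) R,
    forall A : forall i, set (X i), (forall i, measurable (A i)) ->
      Q [set y | forall i, A i (y i)] = (\prod_(i < n) P i (A i))%E.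
Proof.
elim: n => [|n IH] in d X P *.
  exists (dirac (point : product_space X)) => A mA.
  rewrite big_ord0 (_ : [set y | _] = setT) ?probability_setT//.
  by apply/seteqP; split => // y _ [].
pose X' (i : 'I_n) := X (lift ord0 i).
have [Q QE] := IH _ X' (fun i => P (lift ord0 i)).
pose f (z : X ord0 * product_space X') : product_space X := dcons z.1 z.2.
have f0 z : f z ord0 = z.1 by rewrite /f dcons0.
have fS z j : f z (lift ord0 j) = z.2 j by rewrite /f dcons_lift.
have mf : measurable_fun setT f.
  apply: measurable_fun_product => i.
  case: (unliftP ord0 i) => [j|] ->.
    rewrite (_ : f ^~ _ = fun z => z.2 j); last by apply/funext.
    exact: (measurableT_comp (measurable_coord X' j) measurable_snd).
  by rewrite (_ : f ^~ _ = fst); last exact/funext.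
pose F : {mfun _ >-> _} := mfun_Sub (mem_set mf).
exists (distribution (P ord0 \x Q)%E F) => A mA.
rewrite big_ord_recl -QE// -product_measure1E//; last first.
  rewrite (_ : [set y | _] =
      \bigcap_(i in [set: 'I_n]) [set y | A (lift ord0 i) (y i)]); last first.
    by apply/seteqP; split => y Ay i; [move=> _; exact: Ay|exact: Ay i I].
  apply: fin_bigcap_measurable; first exact: finite_finset.
  move=> i _; rewrite -[X in measurable X]setTI.
  exact: (measurable_coord X' i).
rewrite /distribution /pushforward; congr ((P ord0 \x Q)%E _).
apply/seteqP; split => z /= => [Az|[Az0 AzS] i].
  by split=> [|i]; [rewrite -f0|rewrite -fS]; exact: Az.
by case: (unliftP ord0 i) => [j|] ->; [rewrite fS|rewrite f0].
Qed.

(* The rectangles form a pi-system generating the product sigma-algebra, so the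
   law chosen here is the only one satisfying product_probabilityE. *)
Definition product_probability n (d : 'I_n -> measure_display)
    (X : forall i, measurableType (d i)) (P : forall i, probability (X i) R)
    : probability (product_space X) R :=
  sval (cid (product_probability_exists P)).

Lemma product_probabilityE n (d : 'I_n -> measure_display)
    (X : forall i, measurableType (d i)) (P : forall i, probability (X i) R)
    (A : forall i, set (X i)) : (forall i, measurable (A i)) ->
  product_probability P [set y | forall i, A i (y i)] =
  (\prod_(i < n) P i (A i))%E.
Proof. exact: (svalP (cid (product_probability_exists P))). Qed.

End product_probability.

Section mixture.
Context d (T : measurableType d) (R : realType).
Variables (e : {i01 R}) (P mu : probability T R).

Definition mixture : set T -> \bar R :=
  measure_add (mscale (1 - e%:num)%:nng P) (mscale e%:num%:nng mu).

HB.instance Definition _ := Measure.on mixture.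

Lemma mixtureE A :
  mixture A = ((1 - e%:num)%:E * P A + e%:num%:E * mu A)%E.
Proof. by rewrite /mixture measure_addE. Qed.

Let mixture_setT : mixture [set: T] = 1%E.
Proof. by rewrite mixtureE !probability_setT !mule1 -EFinD subrK. Qed.

HB.instance Definition _ :=
  Measure_isProbability.Build _ _ _ mixture mixture_setT.

End mixture.

(* One version of dnu/dP; when [nu `<< P] it takes finite values only
   (Radon_Nikodym_fin_num). *)
Notation density nu P :=
  ('d (charge_of_finite_measure nu) '/d P).

(* Convergence of the distribution functions at the continuity points of the
   limit. The variables may be infinite with positive probability whereas the
   limit law is carried by the reals: mass at -oo is counted on the left, mass
   at +oo is not. *)
Definition cvg_in_distribution (R : realType) (d : nat -> measure_display)
    (Om : forall n, measurableType (d n)) (P : forall n, probability (Om n) R)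
    (Z : forall n, Om n -> \bar R) (L : probability (measurableTypeR R) R) :=
  forall x : R, {for x, continuous (fun t => L `]-oo, t]%classic)} ->
    P n [set w | (Z n w <= x%:E)%E] @[n --> \oo] --> L `]-oo, x]%classic.

Unset Implicit Arguments.

Section detection.
Context (R : realType) (k : nat -> nat)
  (d : forall n, 'I_(k n) -> measure_display)
  (X : forall n i, measurableType (d n i))
  (P : forall n i, probability (X n i) R).

Record signal_model := SignalModel {
  signal : forall n i, probability (X n i) R;
  signal_dominated : forall n i, signal n i `<< P n i;
  strength : forall n, 'I_(k n) -> {i01 R};
  strength_cvg0 :
    \big[Num.max/0]_(i < k n) (strength n i)%:num @[n --> \oo] --> (0 : R)
}.

Implicit Types theta : signal_model.

Definition noise_law n : probability (product_space (X n)) R :=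
  product_probability (P n).

Definition coord_law theta n i : probability (X n i) R :=
  mixture (strength theta n i) (P n i) (signal theta n i).

Definition model_law theta n : probability (product_space (X n)) R :=
  product_probability (coord_law theta n).

(* Extended-valued: [lne] sends 0 to -oo. *)
Definition loglik theta n (y : product_space (X n)) : \bar R :=
  (\sum_(i < k n) lne (density (coord_law theta n i) (P n i) (y i)))%E.

Definition lr_test theta (c : nat -> R) n : product_space (X n) -> R :=
  \1_[set y | ((c n)%:E < loglik theta n y)%E].

Definition signal_density theta n i (x : X n i) : R :=
  fine (density (signal theta n i) (P n i) x).

(* Since +oo - +oo = -oo in [\bar R], this value is finite exactly when the
   product of the centred densities is integrable. *)
Definition signal_cov theta theta' n i : \bar R :=
  covariance (P n i) (signal_density theta n i) (signal_density theta' n i).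

Definition cov_sum theta theta' n : R :=
  \sum_(i < k n) (strength theta n i)%:num * (strength theta' n i)%:num
                 * fine (signal_cov theta theta' n i).

End detection.

Arguments signal_model {R k d X} P.
Arguments SignalModel {R k d X P}.
Arguments signal {R k d X P} _ n i.
Arguments signal_dominated {R k d X P} _ n i.
Arguments strength {R k d X P} _ n i.
Arguments strength_cvg0 {R k d X P} _.
Arguments noise_law {R k d X} P n.
Arguments coord_law {R k d X P} theta n i.
Arguments model_law {R k d X P} theta n.
Arguments loglik {R k d X P} theta n y.
Arguments lr_test {R k d X P} theta c n y.
Arguments signal_density {R k d X P} theta n i x.
Arguments signal_cov {R k d X P} theta theta' n i.
Arguments cov_sum {R k d X P} theta theta' n.

Set Implicit Arguments.

Definition normal_cdf (R : realType) (x : R) : R :=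
  fine (normal_prob 0 1 `]-oo, x]%classic).

(* [ord0] and [ord_max] index the first and the second model. *)
Definition ARE (R : realType) (gamma : 'I_2 -> 'I_2 -> R) : R :=
  gamma ord0 ord_max ^+ 2 / (gamma ord0 ord0 * gamma ord_max ord_max).

(* Main.v *)
(** Write [A_i], [B_i] for the centred likelihood ratios
    [eps_i (d mu_i / d P_i - 1)] of the first and the second model, so that
    [d Q_i / d P_i = 1 + A_i] and the second statistic is [T = sum ln (1 + B_i)].

    Lindeberg's condition: under the noise [E exp(T/2)] is the product of the
    [1 - u_i], where [u_i = E (1 - sqrt (1 + B_i))^2 / 2], and asymptotic
    normality bounds its upper limit by [exp(-s^2/8)].  As [sum E B_i^2]
    tends to [s^2] and [u_i] falls short of [E B_i^2 / 8] by a fixed fraction of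
    [E B_i^2 1{B_i > eta}], the sum of these truncated moments vanishes.

    Le Cam's third lemma: for a smooth [h], the integrals of [h (x + ln (1 + B_i))]
    under [Q_i] and of [h (x + E (A_i B_i) + ln (1 + B_i))] under [P_i] agree to
    first order, uniformly in [x]. Exchanging the coordinates one at a time, the
    errors add up to a term controlled by Lindeberg's condition, so the law of
    [T] under the first alternative is asymptotically that of [T + gamma] under
    the noise; smooth steps then sandwich the rejection indicator. *)

Require Import Defs.
From HB Require Import structures.
From mathcomp Require Import all_boot all_order all_algebra.
From mathcomp Require Import interval_inference.
From mathcomp Require Import all_classical all_reals all_analysis.
From mathcomp Require Import measurable_realfun.
From mathcomp Require Import ring lra.

Set Implicit Arguments.
Unset Strict Implicit.
Unset Printing Implicit Defensive.

Import Order.TTheory GRing.Theory Num.Theory.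
Import numFieldNormedType.Exports.

Local Open Scope classical_set_scope.
Local Open Scope ring_scope.

(** * Product measures *)

(** The usual third lemma starts from a joint limit law of both statistics under the noise; here
    only separate limits are given, so the shift is produced coordinate by coordinate. As
    [E A_i = 0], the change of measure [1 + A_i] acts on [h (x + ln (1 + B_i))] to first order only
    through [E (A_i B_i)], exactly as a deterministic shift by that number does. The sums of second
    moments stay bounded but do not vanish. The remainder is of size [|A_i| min(|B_i|, B_i^2)],
    hence negligible only where [B_i] is small: this is where Lindeberg's condition is needed. It
    may be one-sided, since [B_i] is bounded below by minus the maximal strength. For that
    condition, the factor [1/8] occurs twice: [(1 - sqrt (1 + x))^2 / 2] behaves like [x^2 / 8] at
    [0], and [E exp(Z/2) = exp(-s^2/8)] for the Gaussian limit. The two match exactly, which leaves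
    no room for large values of [B_i]. Since [exp(T/2)] is unbounded, weak convergence does not
    apply to it directly; [E exp(T) = 1] controls the part cut off, and the rest is a finite
    combination of tail probabilities. *)

Section bounded_expectation.
Context d (T : measurableType d) (R : realType) (P : probability T R).
Implicit Types f g : T -> R.

Lemma integrable_bounded f M : measurable_fun setT f ->
  (forall x, `|f x| <= M) -> P.-integrable setT (EFin \o f).
Proof.
move=> mf fM; apply: measurable_bounded_integrable => //.
  by rewrite -ge0_fin_numE// fin_num_measure.
exists M; split; first exact: num_real.
by move=> x Mx y _; rewrite /= (le_trans (fM y)) ?ltW.
Qed.

Lemma integrable_itv01 f : measurable_fun setT f ->
  (forall x, 0 <= f x <= 1) -> P.-integrable setT (EFin \o f).
Proof.
move=> mf f01; apply: (@integrable_bounded _ 1) => // x.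
by have /andP[f0 f1] := f01 x; rewrite ger0_norm.
Qed.

Lemma EFin_Rintegral f : P.-integrable setT (EFin \o f) ->
  (\int[P]_x f x)%:E = (\int[P]_x (f x)%:E)%E.
Proof. by move=> fi; rewrite /Rintegral fineK// integrable_fin_num. Qed.

Lemma Rintegral_prob_cst (c : R) : \int[P]_x c = c.
Proof. by rewrite Rintegral_cst// [X in fine X]probability_setT mulr1. Qed.

Lemma Rintegral_itv01 f : measurable_fun setT f ->
  (forall x, 0 <= f x <= 1) -> 0 <= \int[P]_x f x <= 1.
Proof.
move=> mf f01; apply/andP; split.
  by apply: Rintegral_ge0 => x _; case/andP: (f01 x).
rewrite -(Rintegral_prob_cst 1); apply: le_Rintegral => //.
- exact: integrable_itv01.
- exact: (@integrable_bounded _ `|1|).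
- by move=> x _; case/andP: (f01 x).
Qed.

Lemma ler_dist_Rintegral f g (M : R) :
  P.-integrable setT (EFin \o f) -> P.-integrable setT (EFin \o g) ->
  (forall x, `|f x - g x| <= M) -> `|\int[P]_x f x - \int[P]_x g x| <= M.
Proof.
move=> fi gi fgM; rewrite -RintegralB//.
have fgi : P.-integrable setT (EFin \o (f \- g)).
  rewrite (_ : _ \o _ = ((EFin \o f) \- (EFin \o g))%E); last exact/funext.
  exact: integrableB.
apply: le_trans (le_normr_Rintegral _ fgi) _ => //.
rewrite -[leRHS]Rintegral_prob_cst; apply: le_Rintegral => //.
- exact: integrable_norm.
- exact: (@integrable_bounded _ `|M|).
- by move=> x _; exact: fgM.
Qed.

End bounded_expectation.

Section bounded_fubini.
Context d1 d2 (T1 : measurableType d1) (T2 : measurableType d2) (R : realType)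
  (P1 : probability T1 R) (P2 : probability T2 R).
Variable f : T1 * T2 -> R.
Hypotheses (mf : measurable_fun setT f) (f01 : forall z, 0 <= f z <= 1).

Let mEf : measurable_fun setT (EFin \o f).
Proof. exact/measurable_EFinP. Qed.

Let Ef0 z : (0 <= (EFin \o f) z)%E.
Proof. by rewrite lee_fin; case/andP: (f01 z). Qed.

Let EFin_inner1 x : (\int[P2]_y f (x, y))%:E = (\int[P2]_y (f (x, y))%:E)%E.
Proof.
rewrite EFin_Rintegral//; apply: integrable_itv01 => //.
by apply: (measurableT_comp mf); exact: measurable_pair1.
Qed.

Let EFin_inner2 y : (\int[P1]_x f (x, y))%:E = (\int[P1]_x (f (x, y))%:E)%E.
Proof.
rewrite EFin_Rintegral//; apply: integrable_itv01 => //.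
by apply: (measurableT_comp mf); exact: measurable_pair2.
Qed.

Lemma measurable_Rintegral_snd :
  measurable_fun setT (fun x => \int[P2]_y f (x, y)).
Proof.
apply/measurable_EFinP; rewrite (_ : _ \o _ =
  fun x => (\int[P2]_y (f (x, y))%:E)%E); last exact/funext.
exact: (measurable_fun_fubini_tonelli_F _ mEf).
Qed.

Lemma measurable_Rintegral_fst :
  measurable_fun setT (fun y => \int[P1]_x f (x, y)).
Proof.
apply/measurable_EFinP; rewrite (_ : _ \o _ =
  fun y => (\int[P1]_x (f (x, y))%:E)%E); last exact/funext.
exact: (measurable_fun_fubini_tonelli_G _ mEf).
Qed.

(** Values in [0, 1] keep every inner integral finite, so Tonelli's theorem survives the passage
    through [fine]. *)
Lemma Rintegral_fubini1 :
  \int[(P1 \x P2)%E]_z f z = \int[P1]_x \int[P2]_y f (x, y).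
Proof.
apply: (congr1 fine); rewrite (fubini_tonelli1 _ mEf)//.
by apply: eq_integral => x _; exact/esym/EFin_inner1.
Qed.

Lemma Rintegral_fubini :
  \int[P1]_x \int[P2]_y f (x, y) = \int[P2]_y \int[P1]_x f (x, y).
Proof.
rewrite -Rintegral_fubini1; apply: (congr1 fine).
rewrite (fubini_tonelli1 _ mEf)// /fubini_F (fubini_tonelli _ mEf)//.
by apply: eq_integral => x _; exact/esym/EFin_inner2.
Qed.

End bounded_fubini.

Section product_induction.
Context (R : realType) n (d : 'I_n.+1 -> measure_display)
  (X : forall i, measurableType (d i)) (P : forall i, probability (X i) R).
Let X' (i : 'I_n) := X (lift ord0 i).
Let P' (i : 'I_n) := P (lift ord0 i).

Definition pcons (z : X ord0 * product_space X') : product_space X :=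
  dcons z.1 z.2.

Lemma pcons0 z : pcons z ord0 = z.1. Proof. by rewrite /pcons dcons0. Qed.

Lemma pcons_lift z j : pcons z (lift ord0 j) = z.2 j.
Proof. by rewrite /pcons dcons_lift. Qed.

Lemma measurable_pcons : measurable_fun setT pcons.
Proof.
apply: measurable_fun_product => i; case: (unliftP ord0 i) => [j|] ->.
  rewrite (_ : (fun _ => _) = fun z => z.2 j); last first.
    by apply/funext => z; exact: pcons_lift.
  exact: (measurableT_comp (measurable_coord X' j) measurable_snd).
by rewrite (_ : (fun _ => _) = fst); last by apply/funext => z; exact: pcons0.
Qed.

HB.instance Definition _ :=
  isMeasurableFun.Build _ _ _ _ pcons measurable_pcons.

(** Both laws agree on rectangles, a pi-system that generates the product sigma-algebra. Since
    [product_probability] is known only through its values on rectangles, this is the gateway to all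
    inductions on the number of coordinates. *)
Lemma product_probability_pcons A : measurable A ->
  product_probability P A =
  distribution (P ord0 \x product_probability P')%E pcons A.
Proof.
pose G : set (set (product_space X)) :=
  [set C | exists2 A : forall i, set (X i), (forall i, measurable (A i)) &
    C = [set y | forall i, A i (y i)]].
have mG C : G C -> measurable C.
  move=> [B mB ->].
  rewrite (_ : [set y | _] = \bigcap_(i in setT) [set y | B i (y i)]); last first.
    by apply/seteqP; split => y By i; [move=> _; exact: By|exact: By i I].
  apply: fin_bigcap_measurable; first exact: finite_finset.
  move=> i _; rewrite -[X in measurable X]setTI.
  exact: (measurable_coord X i).
apply: (measure_unique G (fun=> setT)).
- apply/seteqP; split; last first.
    by apply: smallest_sub => //; exact: sigma_algebra_measurable.
  apply: smallest_sub; first exact: smallest_sigma_algebra.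
  move=> _ [i [B [mB ->]]]; apply: sub_sigma_algebra.
  (* A cylinder written as a rectangle: [B] is transported along [j = i], and for every other [j]
     the condition is vacuous, so that side is the whole space. *)
  exists (fun j => [set x | forall e : j = i, B (ecast j (X j) e x)]).
    move=> j; have [ji|ji] := pselect (j = i).
      subst i; rewrite (_ : [set x | _] = B)//; apply/seteqP; split => x.
        by move=> /(_ erefl).
      by move=> Bx e; rewrite (eq_irrelevance e erefl).
    rewrite (_ : [set x | _] = setT)//; apply/seteqP; split => // x _ e.
    by exfalso; exact: ji.
  apply/seteqP; split => y /=.
    by move=> By j e; subst i.
  by move=> /(_ i erefl).
- move=> _ _ [A1 mA1 ->] [A2 mA2 ->].
  exists (fun i => A1 i `&` A2 i); first by move=> i; exact: measurableI.
  apply/seteqP; split => y /= => [[y1 y2] i|y12]; first by split.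
  by split=> i; have [] := y12 i.
- by move=> _; exists (fun=> setT) => //; apply/seteqP; split.
- by apply/seteqP; split => // y _; exists 0%N.
- move=> _ [B mB ->]; rewrite [LHS]product_probabilityE//.
  rewrite big_ord_recl.
  transitivity ((P ord0 \x product_probability P')%E
      (B ord0 `*` [set y | forall i, B (lift ord0 i) (y i)])); last first.
    congr ((P ord0 \x product_probability P')%E _).
    apply/seteqP; split => z /= => [[Bz0 BzS] i|Bz].
      by case: (unliftP ord0 i) => [j|] ->; [rewrite pcons_lift|rewrite pcons0].
    by split=> [|i]; [rewrite -pcons0|rewrite -pcons_lift]; exact: Bz.
  rewrite [RHS]product_measure1E//.
    congr (_ * _)%E; apply/esym.
    exact: (@product_probabilityE _ _ _ _ P' (fun i => B (lift ord0 i))).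
  rewrite (_ : [set y | _] =
      \bigcap_(i in [set: 'I_n]) [set y | B (lift ord0 i) (y i)]); last first.
    by apply/seteqP; split => y By i; [move=> _; exact: By|exact: By i I].
  apply: fin_bigcap_measurable; first exact: finite_finset.
  move=> i _; rewrite -[X in measurable X]setTI.
  exact: (measurable_coord X' i).
- by move=> _; rewrite -ge0_fin_numE// fin_num_measure.
Qed.

Lemma ge0_integral_pcons (f : product_space X -> \bar R) :
  measurable_fun setT f -> (forall y, 0 <= f y)%E ->
  (\int[product_probability P]_y f y =
   \int[(P ord0 \x product_probability P')%E]_z f (pcons z))%E.
Proof.
move=> mf f0; rewrite -(ge0_integral_distribution pcons mf f0).
by apply: eq_measure_integral => A mA _; exact: product_probability_pcons.
Qed.

Lemma Rintegral_pcons (f : product_space X -> R) :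
  measurable_fun setT f -> (forall y, 0 <= f y <= 1) ->
  \int[product_probability P]_y f y =
  \int[P ord0]_x \int[product_probability P']_y f (pcons (x, y)).
Proof.
move=> mf f01.
have mfp : measurable_fun setT (f \o pcons).
  exact: (measurableT_comp mf measurable_pcons).
rewrite -(Rintegral_fubini1 _ _ mfp); last by move=> z; exact: f01.
apply: (congr1 fine); rewrite ge0_integral_pcons//.
  exact/measurable_EFinP.
by move=> y; rewrite lee_fin; case/andP: (f01 y).
Qed.

End product_induction.

Lemma product_probability_coord (R : realType) n (d : 'I_n -> measure_display)
    (X : forall i, measurableType (d i)) (P : forall i, probability (X i) R)
    i (B : set (X i)) : measurable B ->
  product_probability P [set y | B (y i)] = P i B.
Proof.
move=> mB; pose A j : set (X j) := [set x | forall e : j = i, B (ecast j (X j) e x)].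
have Ai : A i = B.
  by apply/seteqP; split => x => [/(_ erefl)//|Bx e]; rewrite (eq_irrelevance e erefl).
have AT j : j != i -> A j = setT.
  by move=> ji; apply/seteqP; split => // x _ e; rewrite e eqxx in ji.
have mA j : measurable (A j).
  by have [->|/AT ->//] := eqVneq j i; rewrite Ai.
rewrite (_ : [set y | _] = [set y | forall j, A j (y j)]); last first.
  by apply/seteqP; split => y /= => [By j e|/(_ i erefl)//]; subst i.
rewrite product_probabilityE// (bigD1 i)//= Ai big1 ?mule1// => j ji.
by rewrite AT// [LHS]probability_setT.
Qed.

(** A null set of one coordinate pulls back to a null cylinder, and there are finitely many
    coordinates. This transfers identities between densities, which hold only almost surely, to the
    product. *)
Lemma ae_product_probability (R : realType) n (d : 'I_n -> measure_display)
    (X : forall i, measurableType (d i)) (P : forall i, probability (X i) R)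
    (A : forall i, set (X i)) :
  (forall i, {ae P i, forall x, A i x}) ->
  {ae product_probability P, forall y, forall i, A i (y i)}.
Proof.
move=> Aae; apply: filter_forall => i.
have [N [mN N0 AN]] := Aae i.
exists [set y | N (y i)]; split.
- by rewrite -[X in measurable X]setTI; exact: (measurable_coord X i).
- by rewrite product_probability_coord.
- by move=> y /= Ay; exact: AN.
Qed.

Lemma integral_product_probability (R : realType) n
    (d : 'I_n -> measure_display) (X : forall i, measurableType (d i))
    (P : forall i, probability (X i) R) (g : forall i, X i -> R) :
  (forall i, measurable_fun setT (g i)) -> (forall i x, 0 <= g i x) ->
  (\int[product_probability P]_y (\prod_(i < n) g i (y i))%:E =
   \prod_(i < n) \int[P i]_x (g i x)%:E)%E.
Proof.
elim: n => [|n IH] in d X P g *.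
  move=> _ _; rewrite big_ord0; under eq_integral do rewrite big_ord0.
  by rewrite integral_cst// [X in (_ * X)%E]probability_setT mule1.
move=> mg g0.
have mprod m (d' : 'I_m -> measure_display) (X' : forall i, measurableType (d' i))
    (g' : forall i, X' i -> R) : (forall i, measurable_fun setT (g' i)) ->
    measurable_fun [set: product_space X'] (fun y => \prod_(i < m) g' i (y i)).
  move=> mg'; apply: measurable_prod => i _.
  exact: (measurableT_comp (mg' i) (measurable_coord X' i)).
rewrite ge0_integral_pcons; last 2 first.
- by apply/measurable_EFinP; exact: mprod.
- by move=> y; rewrite lee_fin; apply: prodr_ge0 => i _; exact: g0.
rewrite fubini_tonelli1//=; last 2 first.
- apply/measurable_EFinP.
  by apply: (measurableT_comp (mprod _ _ _ _ mg)); exact: measurable_pcons.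
- by move=> y; rewrite lee_fin; apply: prodr_ge0 => i _; exact: g0.
rewrite big_ord_recl -IH//.
set J := (\int[product_probability _]_y _)%E.
have J0 : (0 <= J)%E.
  by apply: integral_ge0 => y _; rewrite lee_fin; apply: prodr_ge0 => i _; exact: g0.
rewrite -ge0_integralZr//; last 2 first.
- exact/measurable_EFinP.
- by move=> x _; rewrite lee_fin.
apply: eq_integral => x _; rewrite /fubini_F /=.
rewrite -ge0_integralZl_EFin//; last 2 first.
- by move=> y _; rewrite lee_fin; apply: prodr_ge0 => i _; exact: g0.
- by apply/measurable_EFinP; exact: (mprod _ _ _ (fun i => g (lift ord0 i))).
apply: eq_integral => y _; rewrite big_ord_recl pcons0 EFinM.
by congr (_ * _%:E)%E; apply: eq_bigr => i _; rewrite pcons_lift.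
Qed.

Lemma measurable_sum_coord (R : realType) n (d : 'I_n -> measure_display)
    (X : forall i, measurableType (d i)) (a : forall i, X i -> R) s :
  (forall i, measurable_fun setT (a i)) ->
  measurable_fun [set: product_space X] (fun y => s + \sum_(i < n) a i (y i)).
Proof.
move=> ma; apply: measurable_funD => //; apply: measurable_sum => i.
exact: (measurableT_comp (ma i) (measurable_coord X i)).
Qed.

(* One coordinate is exchanged at a time; the remaining sum acts as a shift. *)
Lemma product_swap (R : realType) n (d : 'I_n -> measure_display)
    (X : forall i, measurableType (d i)) (P Q : forall i, probability (X i) R)
    (a b : forall i, X i -> R) (h : R -> R) (e : 'I_n -> R) :
  (forall i, measurable_fun setT (a i)) ->
  (forall i, measurable_fun setT (b i)) ->
  measurable_fun setT h -> (forall x, 0 <= h x <= 1) ->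
  (forall i s,
     `|\int[P i]_x h (s + a i x) - \int[Q i]_x h (s + b i x)| <= e i) ->
  forall s, `|\int[product_probability P]_y h (s + \sum_(i < n) a i (y i)) -
              \int[product_probability Q]_y h (s + \sum_(i < n) b i (y i))|
            <= \sum_(i < n) e i.
Proof.
elim: n => [|n IH] in d X P Q a b e *; move=> ma mb mh h01 hab s.
  rewrite big_ord0.
  under eq_Rintegral do rewrite big_ord0.
  under [X in _ - X]eq_Rintegral do rewrite big_ord0.
  by rewrite !Rintegral_prob_cst subrr normr0.
have msum := measurable_sum_coord.
rewrite Rintegral_pcons//; last exact: (measurableT_comp mh (msum _ _ _ _ _ _ ma)).
rewrite [X in _ - X]Rintegral_pcons//; last first.
  exact: (measurableT_comp mh (msum _ _ _ _ _ _ mb)).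
pose a' i := a (lift ord0 i); pose b' i := b (lift ord0 i).
pose P' i := P (lift ord0 i); pose Q' i := Q (lift ord0 i).
have aE (z : X ord0 * product_space (fun i => X (lift ord0 i))) :
    s + \sum_(i < n.+1) a i (pcons z i) = s + a ord0 z.1 + \sum_(i < n) a' i (z.2 i).
  rewrite big_ord_recl pcons0 addrA; congr (_ + _).
  by apply: eq_bigr => i _; rewrite pcons_lift.
have bE (z : X ord0 * product_space (fun i => X (lift ord0 i))) :
    s + \sum_(i < n.+1) b i (pcons z i) = s + b ord0 z.1 + \sum_(i < n) b' i (z.2 i).
  rewrite big_ord_recl pcons0 addrA; congr (_ + _).
  by apply: eq_bigr => i _; rewrite pcons_lift.
have mz (a0 : X ord0 -> R) (a1 : forall i, X (lift ord0 i) -> R) :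
    measurable_fun setT a0 -> (forall i, measurable_fun setT (a1 i)) ->
    measurable_fun setT (fun z : X ord0 * product_space (fun i => X (lift ord0 i)) =>
      h (s + a0 z.1 + \sum_(i < n) a1 i (z.2 i))).
  move=> ma0 ma1; apply: (measurableT_comp mh).
  rewrite (_ : (fun _ => _) =
    fun z => (s + a0 z.1) + (0 + \sum_(i < n) a1 i (z.2 i))); last first.
    by apply/funext => z; rewrite add0r.
  apply: measurable_funD.
    by apply: measurable_funD => //; exact: (measurableT_comp ma0).
  exact: (measurableT_comp (msum _ _ _ _ _ 0 ma1) measurable_snd).
rewrite (_ : \int[P ord0]_x _ = \int[P ord0]_x \int[product_probability P']_y
    h (s + a ord0 x + \sum_(i < n) a' i (y i))); last first.
  by apply: eq_Rintegral => x _; apply: eq_Rintegral => y _; rewrite aE.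
rewrite (_ : \int[Q ord0]_x _ = \int[Q ord0]_x \int[product_probability Q']_y
    h (s + b ord0 x + \sum_(i < n) b' i (y i))); last first.
  by apply: eq_Rintegral => x _; apply: eq_Rintegral => y _; rewrite bE.
rewrite (Rintegral_fubini (Q ord0) _ (mz (b ord0) b' _ _))//.
(* The hybrid expectation: the first coordinate already uses [P] and [a], the others still [Q] and
   [b]. With the first coordinate integrated innermost, [hab] compares [M] with the [Q] side; with
   it outermost, the induction hypothesis with shift [s + a ord0 x] compares [M] with the [P]
   side. *)
pose M := \int[P ord0]_x \int[product_probability Q']_y
    h (s + a ord0 x + \sum_(i < n) b' i (y i)).
have ME : M = \int[product_probability Q']_y \int[P ord0]_x
    h (s + a ord0 x + \sum_(i < n) b' i (y i)).
  by rewrite /M (Rintegral_fubini (P ord0) _ (mz (a ord0) b' _ _)).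
apply: (le_trans (ler_distD M _ _)); rewrite big_ord_recl addrC; apply: lerD.
  rewrite ME; apply: ler_dist_Rintegral.
  - apply: integrable_itv01.
      exact: (measurable_Rintegral_fst _ (mz (a ord0) b' _ _)).
    move=> y; apply: Rintegral_itv01 => //.
    exact: (measurableT_comp (mz (a ord0) b' _ _) (measurable_pair2 y)).
  - apply: integrable_itv01.
      exact: (measurable_Rintegral_fst _ (mz (b ord0) b' _ _)).
    move=> y; apply: Rintegral_itv01 => //.
    exact: (measurableT_comp (mz (b ord0) b' _ _) (measurable_pair2 y)).
  - move=> y; under eq_Rintegral do rewrite -addrA (addrC (a _ _)) addrA.
    under [X in _ - X]eq_Rintegral do rewrite -addrA (addrC (b _ _)) addrA.
    exact: hab.
rewrite /M; apply: ler_dist_Rintegral.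
- apply: integrable_itv01.
    exact: (measurable_Rintegral_snd _ (mz (a ord0) a' _ _)).
  move=> y; apply: Rintegral_itv01 => //.
  exact: (measurableT_comp (mz (a ord0) a' _ _) (measurable_pair1 y)).
- apply: integrable_itv01.
    exact: (measurable_Rintegral_snd _ (mz (a ord0) b' _ _)).
  move=> y; apply: Rintegral_itv01 => //.
  exact: (measurableT_comp (mz (a ord0) b' _ _) (measurable_pair1 y)).
- by move=> x; exact: IH.
Qed.

(** * The normal distribution function *)

Section staircase.
Context (R : realType).
Implicit Types w delta : R.

(** A layer-cake sum with mesh [delta], capped at height [K * delta]. Its expectation is a finite
    combination of tail probabilities, hence passes to the limit under convergence in
    distribution. *)
Definition staircase delta K w : R :=
  \sum_(k < K) delta * (k.+1%:R * delta < w)%R%:R.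

Let staircaseP delta K w : 0 < delta -> 0 <= w ->
  if w <= K%:R * delta then staircase delta K w <= w <= delta + staircase delta K w
  else staircase delta K w == K%:R * delta.
Proof.
move=> d0 w0; elim: K => [|K IH].
  rewrite /staircase big_ord0 mul0r; case: ifPn => // w_le0.
  by rewrite w0 (le_trans w_le0)// addr0 ltW.
rewrite /staircase big_ord_recr/= -/(staircase delta K w).
have KS : K.+1%:R * delta = K%:R * delta + delta by rewrite -natr1 mulrDl mul1r.
move: IH; rewrite KS; have [wK|wK] := leP w (K%:R * delta) => IH.
  have wK1 : w <= K%:R * delta + delta by rewrite (le_trans wK)// lerDl ltW.
  by rewrite wK1 ltNge wK1 /= mulr0 addr0.
have [wK1|wK1] := leP w (K%:R * delta + delta); last first.
  by rewrite (eqP IH) mulr1.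
by rewrite (eqP IH) mulr0 addr0 (ltW wK) addrC wK1.
Qed.

Lemma staircase_le delta K w : 0 < delta -> 0 <= w -> staircase delta K w <= w.
Proof.
move=> d0 w0; have := staircaseP K d0 w0; case: ifPn => [_ /andP[]//|].
by rewrite -ltNge => /ltW wK /eqP ->.
Qed.

(** Below the cap the staircase misses at most one mesh. Above it, [w] is at most [w ^+ 2] divided
    by the cap, which a second moment of [w] controls. *)
Lemma staircase_ge delta K w : 0 < delta -> 0 <= w ->
  w <= delta + staircase delta K.+1 w + w ^+ 2 / (K.+1%:R * delta).
Proof.
move=> d0 w0; have Kd : 0 < K.+1%:R * delta by rewrite mulr_gt0.
have := staircaseP K.+1 d0 w0; case: ifPn => [_ /andP[_ wS]|].
  by rewrite (le_trans wS)// lerDl divr_ge0// ?sqr_ge0// ltW.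
rewrite -ltNge => wK /eqP SE.
apply: (@le_trans _ _ (w ^+ 2 / (K.+1%:R * delta))).
  by rewrite ler_pdivlMr// expr2 ler_wpM2l// ltW.
by rewrite lerDr SE addr_ge0// ltW.
Qed.

End staircase.

Section normal_cdf.
Context (R : realType).
Implicit Types m s x y : R.

Lemma normal_prob_cdf m s x : 0 < s ->
  normal_prob m s `]-oo, x]%classic = (normal_cdf ((x - m) / s))%:E.
Proof.
move=> s0; rewrite /normal_cdf fineK ?fin_num_measure//.
pose F (z : R^o) : R^o := (z - m) / s.
have dF (z : R) : is_derive (z : R^o) (1 : R^o) F s^-1.
  rewrite /F; apply: is_derive_eq; rewrite ?scaler0 ?add0r ?addr0 ?subr0 ?scaler1//.
have F'E : F^`()%classic = cst s^-1.
  by apply/funext => z; rewrite derive1E; have [_ ->] := dF z.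
rewrite /normal_prob -[(x - m) / s]/(F x).
rewrite (@increasing_ge0_integration_by_substitutionNy _ F); last 8 first.
- by move=> y z _ _ yz; rewrite /F ltr_pM2r ?invr_gt0// ltrD2r.
- by move=> z _; rewrite F'E; exact: cvg_cst.
- by rewrite F'E; exact: is_cvg_cst.
- by rewrite F'E; exact: cvg_cst.
- split.
    by move=> z _; have [] := dF z.
  apply: cvg_at_left_filter; apply: differentiable_continuous.
  by apply/derivable1_diffP; have [] := dF x.
- apply/gt0_cvgMlNy; first by rewrite invr_gt0.
  exact: cvg_addrr_Ny.
- by apply: continuous_subspaceT; exact: continuous_normal_pdf.
- by move=> z _; exact: normal_pdf_ge0.
apply: eq_integral => z _; congr (_%:E); rewrite F'E /= /cst/=.
change (normal_pdf m s z = normal_pdf 0 1 ((z - m) / s) * s^-1).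
rewrite !normal_pdfE ?gt_eqF// /normal_peak /normal_fun subr0.
have -> : Num.sqrt (s ^+ 2 * pi *+ 2) = s * Num.sqrt (1 ^+ 2 * pi *+ 2).
  by rewrite expr1n mul1r -mulrnAr sqrtrM ?sqr_ge0// sqrtr_sqr gtr0_norm.
rewrite invfM [s^-1 * _]mulrC mulrAC; congr (_ * expR _ * _).
by field; rewrite gt_eqF.
Qed.

Lemma normal_cdf_itv x y : x <= y ->
  (normal_cdf y - normal_cdf x)%:E = normal_prob 0 1 `]x, y]%classic.
Proof.
move=> xy; have := @normal_prob_cdf 0 1 y ltr01.
rewrite subr0 divr1 (@itv_bndbnd_setU _ _ -oo%O (BRight x) (BRight y))//.
rewrite measureU//; last first.
  by apply/seteqP; split => // z /=; rewrite !in_itv/= => -[]; lra.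
rewrite [X in (X + _)%E](@normal_prob_cdf 0 1 x ltr01) subr0 divr1 EFinB => <-.
by rewrite addeAC subee// add0e.
Qed.

Lemma normal_cdf_lipschitz x y : x <= y ->
  0 <= normal_cdf y - normal_cdf x <= normal_peak 1 * (y - x).
Proof.
move=> xy; rewrite -2!lee_fin normal_cdf_itv//; apply/andP; split => //.
rewrite /normal_prob.
apply: (@le_trans _ _ (\int[lebesgue_measure]_(z in `]x, y]) (normal_peak 1)%:E)%E).
  apply: ge0_le_integral => //.
  - by move=> z _; rewrite lee_fin normal_pdf_ge0.
  - by apply/measurable_EFinP/measurable_funTS; exact: measurable_normal_pdf.
  - by move=> z _; rewrite lee_fin normal_pdf_ub.
rewrite integral_cst//= lebesgue_measure_itv/= lte_fin.
case: ifPn => _; first by rewrite -EFinB -EFinM.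
by rewrite mule0 lee_fin mulr_ge0 ?subr_ge0// normal_peak_ge0.
Qed.

Lemma normal_cdf_continuous : continuous (@normal_cdf R).
Proof.
move=> x; apply/cvgrPdist_le => e e0.
have p0 : 0 < normal_peak (1 : R) by rewrite normal_peak_gt0.
near=> y.
have yx : `|x - y| <= e / normal_peak 1.
  near: y; apply/nbhs_ballP; exists (e / normal_peak 1).
    exact: divr_gt0.
  by move=> y /ltW.
move: yx; rewrite ler_pdivlMr// mulrC => /(le_trans _); apply.
have [xy|/ltW yx] := leP x y.
  by rewrite distrC [in leRHS]distrC; have := normal_cdf_lipschitz xy;
    move=> /andP[? ?]; rewrite !ger0_norm// subr_ge0.
by have /andP[? ?] := normal_cdf_lipschitz yx; rewrite !ger0_norm// subr_ge0.
Unshelve. all: by end_near. Qed.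

(** Strictness is what later lets the levels of the tests determine the limit of the critical
    values. *)
Lemma normal_cdf_lt x y : x < y -> normal_cdf x < normal_cdf y.
Proof.
move=> xy; rewrite -subr_gt0 -lte_fin normal_cdf_itv ?ltW//.
(* The density at [|x| + |y|]: a positive lower bound on the whole interval, where the argument has
   absolute value at most [|x| + |y|]. *)
pose b := normal_peak 1 * expR (- (`|x| + `|y|) ^+ 2 / (1 ^+ 2 *+ 2)) : R.
have b0 : 0 < b by rewrite mulr_gt0 ?expR_gt0 ?normal_peak_gt0.
apply: (@lt_le_trans _ _ (\int[lebesgue_measure]_(z in `]x, y]) b%:E)%E).
  rewrite integral_cst//= lebesgue_measure_itv/= lte_fin xy -EFinB -EFinM.
  by rewrite lte_fin mulr_gt0// subr_gt0.
apply: ge0_le_integral => //.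
- by move=> z _; rewrite lee_fin ltW.
- by apply/measurable_EFinP/measurable_funTS; exact: measurable_normal_pdf.
- move=> z /=; rewrite in_itv/= => /andP[xz zy].
  rewrite lee_fin normal_pdfE// ler_wpM2l ?normal_peak_ge0// ler_expR.
  rewrite subr0 ler_pM2r ?invr_gt0// lerN2.
  rewrite -[leLHS]real_normK ?num_real// ler_sqr ?nnegrE ?addr_ge0//.
  rewrite ler_norml; have := ler_norm y; have := ler_norm (- x); rewrite normrN.
  have := normr_ge0 x; have := normr_ge0 y; lra.
Qed.

Lemma normal_cdfN x : normal_cdf (- x) = 1 - normal_cdf x.
Proof.
apply: EFin_inj; rewrite EFinB.
have := @normal_prob_cdf 0 1 (- x) ltr01; rewrite subr0 divr1 => <-.
have := @normal_prob_cdf 0 1 x ltr01; rewrite subr0 divr1 => <-.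
rewrite {1}/normal_prob ge0_integration_by_substitutionNy; last 2 first.
- by apply: continuous_subspaceT; exact: continuous_normal_pdf.
- by move=> z _; exact: normal_pdf_ge0.
rewrite (_ : integral _ _ _ = normal_prob 0 1 `[x, +oo[%classic); last first.
  apply: eq_integral => z _ /=; rewrite !normal_pdfE// /normal_fun !subr0.
  by rewrite sqrrN.
rewrite -setCitvl probability_setC//; congr (_ - _)%E.
transitivity (\int[lebesgue_measure]_(z in `]-oo, x[) (normal_pdf 0 1 z)%:E)%E.
  by [].
rewrite integral_itv_bndo_bndc//.
by apply/measurable_EFinP/measurable_funTS; exact: measurable_normal_pdf.
Qed.

Lemma normal_prob_tail m s x : 0 < s ->
  normal_prob m s `]x, +oo[%classic = (1 - normal_cdf ((x - m) / s))%:E.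
Proof.
by move=> s0; rewrite -setCitvl probability_setC//
  [X in (_ - X)%E](normal_prob_cdf _ _ s0) EFinB.
Qed.

(* Lower Riemann sum of [E exp(Z/2)] for [Z] normal with mean [-s^2/2] and
   variance [s^2]; completing the square gives [E exp(Z/2) = exp(-s^2/8)]. *)
Lemma staircase_normal s delta K : 0 < s -> 0 < delta ->
  \sum_(k < K) delta *
    (1 - normal_cdf ((2 * ln (k.+1%:R * delta) + s ^+ 2 / 2) / s)) <=
  expR (- (s ^+ 2 / 8)).
Proof.
move=> s0 d0; rewrite -lee_fin -sumEFin.
(* The set where [exp(z/2)] exceeds the step level [k.+1 * delta]. *)
pose A (k : nat) := `]2 * ln (k.+1%:R * delta), +oo[%classic : set R.
pose p := normal_pdf (- (s ^+ 2 / 2)) s.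
have mp : measurable_fun setT p by exact: measurable_normal_pdf.
have p0 z : 0 <= p z by exact: normal_pdf_ge0.
have mA k : measurable (A k) by exact: measurable_itv.
have mI k : measurable_fun setT (fun z => p z * \1_(A k) z).
  exact: measurable_funM.
rewrite (eq_bigr (fun k : 'I_K => \int[lebesgue_measure]_z
    (delta * ((p z) * \1_(A k) z))%:E)%E); last first.
  move=> k _; rewrite -(opprK (s ^+ 2 / 2)) EFinM -normal_prob_tail// -/(A k).
  under eq_integral do rewrite EFinM.
  rewrite ge0_integralZl_EFin//; last 3 first.
  - by move=> z _; rewrite lee_fin mulr_ge0.
  - by apply/measurable_EFinP; exact: mI.
  - exact: ltW.
  congr (_ * _)%E.
  transitivity (\int[lebesgue_measure]_(z in A k) (p z)%:E)%E; first by [].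
  rewrite [LHS]integral_mkcond epatch_indic.
  by apply: eq_integral => z _; rewrite /= EFinM.
rewrite -ge0_integral_sum//; last 2 first.
- move=> k; apply/measurable_EFinP; exact: measurable_funM (mI _).
- by move=> k z _; rewrite lee_fin !mulr_ge0// ltW.
apply: (@le_trans _ _ (\int[lebesgue_measure]_z
    ((expR (- (s ^+ 2 / 8)))%:E * (normal_pdf 0 s z)%:E)))%E; last first.
  rewrite ge0_integralZl_EFin ?expR_ge0//; last 2 first.
  - by move=> z _; rewrite lee_fin normal_pdf_ge0.
  - by apply/measurable_EFinP; exact: measurable_normal_pdf.
  by rewrite integral_normal_pdf mule1.
apply: ge0_le_integral => //.
- by move=> z _; apply: sume_ge0 => k _; rewrite lee_fin !mulr_ge0// ltW.
- apply: emeasurable_sum => k; apply/measurable_EFinP.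
  exact: measurable_funM (mI _).
- apply/measurable_EFinP; apply: measurable_funM => //.
  exact: measurable_normal_pdf.
move=> z _; rewrite sumEFin -EFinM lee_fin.
(* Tilting by [exp(z/2)] moves the mean from [-s^2/2] to [0] and leaves the factor [exp(-s^2/8)]. *)
rewrite (_ : expR _ * _ = expR (z / 2) * p z); last first.
  rewrite /p !normal_pdfE ?gt_eqF// !(mulrCA _ (normal_peak s)); congr (_ * _).
  rewrite /normal_fun -!expRD; congr expR.
  by field; rewrite gt_eqF.
apply: (@le_trans _ _ (staircase delta K (expR (z / 2)) * p z)); last first.
  by rewrite ler_wpM2r// staircase_le// expR_ge0.
rewrite /staircase mulr_suml; apply: ler_sum => k _.
rewrite -!mulrA ler_wpM2l ?(ltW d0)// mulrC ler_wpM2r//.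
rewrite indicE ler_nat; case: (boolP (z \in A k)) => //.
rewrite inE /A/= in_itv/= andbT => Az.
have kd0 : 0 < k.+1%:R * delta by rewrite mulr_gt0.
rewrite -[X in (X < _)%R]lnK ?posrE// ltr_expR ltr_pdivlMr//.
by rewrite mulrC Az.
Qed.

End normal_cdf.

(** * Pointwise estimates *)

Section integrable_real.
Context d (T : measurableType d) (R : realType) (P : probability T R).
Implicit Types f g : T -> R.

Definition rintegrable f := P.-integrable setT (EFin \o f).

Lemma rintegrable_measurable f : rintegrable f -> measurable_fun setT f.
Proof. by move=> /integrableP[/measurable_EFinP]. Qed.

Lemma rintegrable_cst (c : R) : rintegrable (fun=> c).
Proof. exact: (@integrable_bounded _ _ _ _ _ `|c|). Qed.

Lemma rintegrableD f g :
  rintegrable f -> rintegrable g -> rintegrable (fun x => f x + g x).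
Proof.
move=> fi gi; rewrite /rintegrable.
rewrite (_ : _ \o _ = ((EFin \o f) \+ (EFin \o g))%E); last exact/funext.
exact: integrableD.
Qed.

Lemma rintegrableB f g :
  rintegrable f -> rintegrable g -> rintegrable (fun x => f x - g x).
Proof.
move=> fi gi; rewrite /rintegrable.
rewrite (_ : _ \o _ = ((EFin \o f) \- (EFin \o g))%E); last exact/funext.
exact: integrableB.
Qed.

Lemma rintegrableZ (c : R) f : rintegrable f -> rintegrable (fun x => c * f x).
Proof.
move=> fi; rewrite /rintegrable.
rewrite (_ : _ \o _ = (fun x => c%:E * (EFin \o f) x)%E); last exact/funext.
exact: integrableZl.
Qed.

Lemma rintegrable_dom f g : measurable_fun setT f -> rintegrable g ->
  (forall x, `|f x| <= g x) -> rintegrable f.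
Proof.
move=> mf gi fg; apply: (le_integrable measurableT _ _ gi).
  exact/measurable_EFinP.
by move=> x _ /=; rewrite lee_fin (le_trans (fg x))// ler_norm.
Qed.

Lemma ler_Rintegral f g : rintegrable f -> rintegrable g ->
  (forall x, f x <= g x) -> \int[P]_x f x <= \int[P]_x g x.
Proof. by move=> fi gi fg; apply: le_Rintegral => // x _; exact: fg. Qed.

Lemma ler_norm_Rintegral f g : measurable_fun setT f -> rintegrable g ->
  (forall x, `|f x| <= g x) -> `|\int[P]_x f x| <= \int[P]_x g x.
Proof.
move=> mf gi fg; have fi := rintegrable_dom mf gi fg.
apply: (le_trans (le_normr_Rintegral _ fi)) => //.
by apply: ler_Rintegral => //; exact: integrable_norm.
Qed.

End integrable_real.

Section pointwise_bounds.
Context (R : realType).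
Implicit Types a b e eta x : R.

Lemma ln1p_le b : - 1 < b -> ln (1 + b) <= b.
Proof.
by move=> b1; rewrite -[leRHS]expRK ler_ln ?posrE ?expR_gt0 ?expR_ge1Dx//; lra.
Qed.

(** The lower bound [b / (1 + b) <= ln (1 + b)] is [ln1p_le] applied to the inverse of [1 + b]. Both
    constants [2] come from [1 / (1 + b) <= 2]. *)
Lemma ln1p_dist b : - (1 / 2) <= b ->
  `|ln (1 + b)| <= 2 * `|b| /\ `|ln (1 + b) - b| <= 2 * b ^+ 2.
Proof.
move=> b2; have b1 : - 1 < b by lra.
have b10 : 0 < 1 + b by lra.
have up := ln1p_le b1.
have lo : b / (1 + b) <= ln (1 + b).
  have inv0 : 0 < (1 + b)^-1 by rewrite invr_gt0.
  have := @ln1p_le ((1 + b)^-1 - 1); rewrite [1 + (_ - 1)]addrC subrK lnV ?posrE// => H.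
  have -> : b / (1 + b) = 1 - (1 + b)^-1 by field; rewrite gt_eqF.
  by have := H ltac:(lra); lra.
have q : b / (1 + b) = b - b ^+ 2 / (1 + b) by field; rewrite gt_eqF.
have iv : (1 + b)^-1 <= 2.
  by rewrite -[leRHS]invrK lef_pV2 ?posrE ?invr_gt0//; lra.
have iv0 : 0 < (1 + b)^-1 by rewrite invr_gt0.
have q2 : b ^+ 2 / (1 + b) <= 2 * b ^+ 2.
  by rewrite mulrC ler_wpM2r// sqr_ge0.
split; last by rewrite ler_norml; apply/andP; split; nra.
have [b0|b0] := leP 0 b.
  rewrite (ger0_norm b0) ler_norml; apply/andP; split; last by lra.
  by apply: le_trans lo; apply: (@le_trans _ _ 0); [lra|exact: divr_ge0 (ltW _)].
rewrite (ltr0_norm b0) ler_norml; apply/andP; split; last by lra.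
apply: le_trans lo; nra.
Qed.

(** Evaluated at a centred likelihood ratio, its expectation is one minus the Hellinger affinity of
    the two laws. *)
Definition hellinger x := (1 - Num.sqrt (1 + x)) ^+ 2 / 2.

Lemma hellingerE x : - 1 <= x -> hellinger x = x / 2 - (Num.sqrt (1 + x) - 1).
Proof.
move=> x1; have : Num.sqrt (1 + x) ^+ 2 = 1 + x by rewrite sqr_sqrtr//; lra.
by rewrite /hellinger sqrrB expr1n mul1r => ->; lra.
Qed.

(** The ratio [hellinger x / x ^+ 2] equals [1 / (2 (1 + sqrt (1 + x))^2)]; it decreases in [x] from
    its limit [1/8] at [0], and the gap is its drop at [eta]. *)
Definition hellinger_gap eta := 1 / 8 - 1 / (2 * (1 + Num.sqrt (1 + eta)) ^+ 2).

Lemma hellinger_gap_gt0 eta : 0 < eta -> 0 < hellinger_gap eta.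
Proof.
move=> eta0; rewrite /hellinger_gap subr_gt0.
have s1 : 1 < Num.sqrt (1 + eta) by rewrite -[ltLHS]sqrtr1 ltr_sqrt; lra.
by rewrite !div1r ltf_pV2 ?posrE//; nra.
Qed.

Let hellinger_factor x : - 1 <= x ->
  hellinger x = x ^+ 2 / (2 * (1 + Num.sqrt (1 + x)) ^+ 2).
Proof.
move=> x1; have ss : Num.sqrt (1 + x) ^+ 2 = 1 + x by rewrite sqr_sqrtr//; lra.
have s0 := sqrtr_ge0 (1 + x); have {2}-> : x = Num.sqrt (1 + x) ^+ 2 - 1 by lra.
by rewrite /hellinger; field; rewrite gt_eqF//; lra.
Qed.

(** For negative [x] the ratio [hellinger x / x ^+ 2] exceeds [1/8], but [sqrt (1 + x) >= 1 - e]
    bounds it by [1 / (2 (2 - e)^2)], hence by [(1 + 2 e) / 8]. Beyond [eta] the ratio lies below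
    [1/8] by at least the gap. *)
Lemma hellinger_le eta e x : 0 < eta -> 0 <= e <= 1 / 2 -> - e <= x ->
  hellinger_gap eta * (x ^+ 2 * (eta < x)%R%:R) <=
  (1 + 2 * e) / 8 * x ^+ 2 - hellinger x.
Proof.
move=> eta0 /andP[e0 e2] ex; rewrite hellinger_factor; last by lra.
set s := Num.sqrt (1 + x); have s0 : 0 <= s by exact: sqrtr_ge0.
have ss : s ^+ 2 = 1 + x by rewrite sqr_sqrtr//; lra.
have x2 := sqr_ge0 x.
have D0 : 0 < 2 * (1 + s) ^+ 2 by nra.
have [xeta|xeta] := ltP eta x; last first.
  rewrite !mulr0 subr_ge0 mulrC ler_wpM2r//.
  rewrite -[leLHS]mul1r ler_pdivrMr//.
  have se : 1 - e <= s by nra.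
  by nra.
rewrite mulr1 /hellinger_gap.
have s1 : Num.sqrt (1 + eta) <= s by rewrite ler_sqrt//; lra.
have r1 := sqrtr_ge0 (1 + eta).
have : 1 / (2 * (1 + s) ^+ 2) <= 1 / (2 * (1 + Num.sqrt (1 + eta)) ^+ 2).
  by rewrite !div1r lef_pV2 ?posrE//; nra.
rewrite !div1r; set u := _^-1; set v := (2 * (1 + Num.sqrt _) ^+ 2)^-1 => uv.
nra.
Qed.

Lemma sqrt1p_ge e x : 0 <= e <= 1 / 2 -> - e <= x -> 1 - e <= Num.sqrt (1 + x).
Proof.
move=> e01 ex; have s0 := sqrtr_ge0 (1 + x).
have : Num.sqrt (1 + x) ^+ 2 = 1 + x by rewrite sqr_sqrtr//; lra.
by nra.
Qed.

(** A converse to [1 - u <= exp(-u)]: one has [1 - u >= exp(-u / (1 - u))], and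
    [1 / (1 - u) <= 1 + 2 e] because [u <= e <= 1/2]. It turns a product of affinities into the
    exponential of a sum. *)
Lemma expR_le_1B e u : 0 <= e <= 1 / 2 -> 0 <= u <= e ->
  expR (- ((1 + 2 * e) * u)) <= 1 - u.
Proof.
move=> e01 ue; have u1 : 0 < 1 - u by lra.
apply: (@le_trans _ _ (expR (- (u / (1 - u))))).
  rewrite ler_expR lerN2 ler_pdivrMr//; nra.
rewrite expRN -[leRHS]invrK lef_pV2 ?posrE ?expR_gt0 ?invr_gt0//.
apply: le_trans (expR_ge1Dx _).
by rewrite le_eqVlt; apply/orP; left; apply/eqP; field; rewrite gt_eqF.
Qed.

(** Weighted AM-GM: the large weight [1 / eta] is put on [b], whose square will be restricted to its
    tail. *)
Lemma ler_absM eta a b : 0 < eta -> `|a| * `|b| <= eta * a ^+ 2 + b ^+ 2 / eta.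
Proof.
move=> eta0; rewrite -(real_normK (num_real a)) -(real_normK (num_real b)).
have := normr_ge0 a; have := normr_ge0 b.
move: `|a| `|b| => u v v0 u0.
have -> : eta * u ^+ 2 + v ^+ 2 / eta =
    (eta * u - v) ^+ 2 / eta + 2 * (u * v) by field; rewrite gt_eqF.
have : 0 <= (eta * u - v) ^+ 2 / eta by rewrite divr_ge0 ?sqr_ge0// ltW.
have := mulr_ge0 u0 v0; lra.
Qed.

(** One-sided, because it is used for [b >= - eta], where a value of modulus above [eta] is
    necessarily positive. *)
Definition tail_sqr eta b := b ^+ 2 * (eta < b)%R%:R.

Lemma tail_sqr_ge0 eta b : 0 <= tail_sqr eta b.
Proof. by rewrite mulr_ge0// sqr_ge0. Qed.

Lemma abs_le_tail eta b : 0 < eta -> - eta <= b ->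
  `|b| <= eta + tail_sqr eta b / eta.
Proof.
move=> eta0 eb; rewrite /tail_sqr; have [be|be] := ltP eta b; last first.
  by rewrite mulr0 mul0r addr0 ler_norml eb be.
rewrite mulr1 gtr0_norm; last by lra.
apply: (@le_trans _ _ (b ^+ 2 / eta)); last by lra.
by rewrite ler_pdivlMr//; nra.
Qed.

Lemma absM_le_tail eta a b : 0 < eta -> - eta <= b ->
  `|a * b| <= eta * (1 + a ^+ 2) + tail_sqr eta b / eta.
Proof.
move=> eta0 eb; rewrite normrM /tail_sqr; have [be|be] := ltP eta b; last first.
  rewrite mulr0 mul0r addr0.
  have bb : `|b| <= eta by rewrite ler_norml eb be.
  rewrite -(real_normK (num_real a)).
  have : `|a| * `|b| <= `|a| * eta by rewrite ler_wpM2l.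
  have : 0 <= eta * (1 + `|a| ^+ 2 - `|a|) by rewrite mulr_ge0 ?ltW//; nra.
  lra.
by rewrite mulr1; have := ler_absM a b eta0; lra.
Qed.

(** [M] stands for a normalized Taylor remainder. For [b <= eta] the quadratic bound on [M] gains a
    factor [eta]; for larger [b] the linear bound and [ler_absM] charge the product to the tail. *)
Lemma taylor_le_tail eta a b M : 0 < eta -> - eta <= b ->
  M <= `|b| -> M <= b ^+ 2 ->
  `|a| * M <= eta * a ^+ 2 + eta * b ^+ 2 + tail_sqr eta b / eta.
Proof.
move=> eta0 eb Mb Mb2; rewrite /tail_sqr; have [be|be] := ltP eta b; last first.
  rewrite mulr0 mul0r addr0.
  have bb : `|b| <= eta by rewrite ler_norml eb be.
  apply: (@le_trans _ _ (`|a| * b ^+ 2)); first by rewrite ler_wpM2l.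
  rewrite -(real_normK (num_real a)) -(real_normK (num_real b)).
  move: (normr_ge0 a) (normr_ge0 b) bb; move: `|a| `|b| => u v u0 v0 ve.
  have : u * v * v <= u * v * eta by rewrite ler_wpM2l// mulr_ge0.
  have : 0 <= eta * (u - v) ^+ 2 by rewrite mulr_ge0 ?sqr_ge0// ltW.
  have : 0 <= eta * (u * v) by rewrite !mulr_ge0// ltW.
  by nra.
apply: (@le_trans _ _ (`|a| * `|b|)); first by rewrite ler_wpM2l.
rewrite mulr1; have := ler_absM a b eta0.
have : 0 <= eta * b ^+ 2 by rewrite mulr_ge0 ?sqr_ge0// ltW.
lra.
Qed.

End pointwise_bounds.

(** * Exchanging one coordinate *)

Section smooth_step.
Context (R : realType).
Implicit Types c delta x y s : R.

Let p x : R := Num.max x 0.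

Let p_cases x : x <= 0 /\ p x = 0 \/ 0 <= x /\ p x = x.
Proof.
rewrite /p; have [x0|x0] := leP x 0; [left; split => //|right; split => //].
by rewrite ltW.
Qed.

(* Half the second difference of [(x_+)^2]: a C^1 step with Lipschitz derivative
   [dstep], rising from 0 at [x = 0] to 1 at [x = 2]. *)
Definition step x : R := (p x ^+ 2 - 2 * p (x - 1) ^+ 2 + p (x - 2) ^+ 2) / 2.

Definition dstep x : R := p x - 2 * p (x - 1) + p (x - 2).

Lemma step_itv01 x : 0 <= step x <= 1.
Proof.
rewrite /step; case: (p_cases x) => -[x0 ->]; case: (p_cases (x - 1)) => -[x1 ->];
  case: (p_cases (x - 2)) => -[x2 ->]; apply/andP; split; nra.
Qed.

Lemma step_eq0 x : x <= 0 -> step x = 0.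
Proof.
rewrite /step; case: (p_cases x) => -[x0 ->]; case: (p_cases (x - 1)) => -[x1 ->];
  case: (p_cases (x - 2)) => -[x2 ->] => ?; nra.
Qed.

Lemma step_eq1 x : 2 <= x -> step x = 1.
Proof.
rewrite /step; case: (p_cases x) => -[x0 ->]; case: (p_cases (x - 1)) => -[x1 ->];
  case: (p_cases (x - 2)) => -[x2 ->] => ?; nra.
Qed.

Lemma dstep_itv01 x : 0 <= dstep x <= 1.
Proof.
rewrite /dstep; case: (p_cases x) => -[x0 ->]; case: (p_cases (x - 1)) => -[x1 ->];
  case: (p_cases (x - 2)) => -[x2 ->]; lra.
Qed.

Let p_lip x y : `|p (x + y) - p x| <= `|y|.
Proof.
rewrite ler_norml; have := ler_norm y; have := ler_norm (- y); rewrite normrN.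
have := normr_ge0 y.
by case: (p_cases x) => -[x0 ->]; case: (p_cases (x + y)) => -[x1 ->]; lra.
Qed.

Let p_taylor x y : 0 <= p (x + y) ^+ 2 - p x ^+ 2 - 2 * p x * y <= y ^+ 2.
Proof.
by case: (p_cases x) => -[x0 ->]; case: (p_cases (x + y)) => -[x1 ->];
  apply/andP; split; nra.
Qed.

Lemma dstep_lipschitz x y : `|dstep (x + y) - dstep x| <= 4 * `|y|.
Proof.
rewrite /dstep (addrAC x y (- 1)) (addrAC x y (- 2)).
have := p_lip x y; have := p_lip (x - 1) y; have := p_lip (x - 2) y.
by rewrite !ler_norml; lra.
Qed.

Lemma step_taylor x y : `|step (x + y) - step x - y * dstep x| <= 4 * y ^+ 2.
Proof.
rewrite /step /dstep (addrAC x y (- 1)) (addrAC x y (- 2)).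
have := p_taylor x y; have := p_taylor (x - 1) y; have := p_taylor (x - 2) y.
have := sqr_ge0 y; rewrite !ler_norml; move: (y ^+ 2) => yy.
move=> ? /andP[? ?] /andP[? ?] /andP[? ?]; apply/andP; split; lra.
Qed.

(** For [|y| <= 1] the constant is [1 + 4], slope plus Taylor remainder; for larger [y] it is enough
    that [step] takes values in [0, 1]. *)
Lemma step_lipschitz x y : `|step (x + y) - step x| <= 5 * `|y|.
Proof.
have /andP[d0 d1] := dstep_itv01 x.
have [y1|y1] := leP `|y| 1.
  have := step_taylor x y; have : `|y * dstep x| <= `|y|.
    by rewrite normrM ler_piMr// ger0_norm.
  have : y ^+ 2 <= `|y|.
    by rewrite -(real_normK (num_real y)); have := normr_ge0 y; nra.
  by rewrite !ler_norml; lra.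
have := step_itv01 x; have := step_itv01 (x + y); rewrite ler_norml; lra.
Qed.

Lemma measurable_step : measurable_fun setT step.
Proof.
have mp c : measurable_fun setT (fun x => p (x - c) ^+ 2).
  apply: measurable_funX; apply: measurable_maxr => //.
  exact: measurable_funB.
apply: measurable_funM => //; apply: measurable_funD => //.
apply: measurable_funB; last exact: measurable_funM.
by have := mp 0; under eq_fun do rewrite subr0.
Qed.

(** The function [h'] plays the derivative only through these inequalities, so no differentiability
    has to be proved for the piecewise quadratic step. *)
Definition smooth_test (C : R) (h h' : R -> R) :=
  [/\ measurable_fun setT h, forall x, 0 <= h x <= 1 &
   [/\ forall x, `|h' x| <= C,
       forall x y, `|h (x + y) - h x| <= C * `|y|,
       forall x y, `|h (x + y) - h x - y * h' x| <= C * y ^+ 2 &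
       forall x y, `|h' (x + y) - h' x| <= C * `|y|]].

(** The constant is chosen before the location [c], so that the step may follow the critical values
    as they move with the sample size. *)
Lemma smooth_test_step delta : 0 < delta -> exists2 C, 0 < C &
  forall c, exists h', smooth_test C (fun x => step ((x - c) / delta)) h'.
Proof.
move=> d0; have i0 : 0 < delta^-1 by rewrite invr_gt0.
exists (5 * (delta^-1 + delta^-1 ^+ 2)).
  by rewrite mulr_gt0// addr_gt0// exprn_gt0.
move=> c; exists (fun x => dstep ((x - c) / delta) / delta).
have shift x y : (x + y - c) / delta = (x - c) / delta + y / delta.
  by rewrite -mulrDl addrAC.
have ny y : `|y / delta| = `|y| * delta^-1 by rewrite normrM (gtr0_norm i0).
have i2 := sqr_ge0 delta^-1.
split; [|by move=> x; exact: step_itv01|split].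
- apply: (measurableT_comp measurable_step).
  by apply: measurable_funM => //; exact: measurable_funB.
- move=> x; have /andP[? ?] := dstep_itv01 ((x - c) / delta).
  rewrite normrM (gtr0_norm i0) ger0_norm//; nra.
- move=> x y; rewrite shift; apply: le_trans (step_lipschitz _ _) _.
  by rewrite ny; have := normr_ge0 y; nra.
- move=> x y; rewrite shift mulrA mulrAC.
  apply: le_trans (step_taylor _ _) _.
  rewrite exprMn; have := sqr_ge0 y; move: (y ^+ 2) => yy yy0.
  have := mulr_ge0 yy0 i2; have := mulr_ge0 yy0 (ltW i0); lra.
- move=> x y; rewrite -mulrBl shift normrM (gtr0_norm i0).
  apply: (@le_trans _ _ (4 * `|y / delta| * delta^-1)).
    by rewrite ler_wpM2r ?(ltW i0)// dstep_lipschitz.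
  rewrite ny; have := normr_ge0 y; move: `|y| => v v0.
  have := mulr_ge0 v0 i2; have := mulr_ge0 v0 (ltW i0); lra.
Qed.

End smooth_step.

Section coordinate_swap.
Context d (T : measurableType d) (R : realType) (P Q : probability T R).
Variables (A B : T -> R) (eta : R).
Hypotheses (mA : measurable_fun setT A) (mB : measurable_fun setT B).
Hypotheses (A2 : rintegrable P (fun x => A x ^+ 2))
  (B2 : rintegrable P (fun x => B x ^+ 2)).
Hypotheses (EA : \int[P]_x A x = 0) (eta0 : 0 < eta).
Hypotheses (Beta : forall x, - eta <= B x) (B12 : forall x, - (1 / 2) <= B x).
Hypothesis QP : forall f : T -> R, measurable_fun setT f ->
  (forall x, 0 <= f x <= 1) -> \int[Q]_x f x = \int[P]_x (f x * (1 + A x)).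

Let a := \int[P]_x A x ^+ 2.
Let b := \int[P]_x B x ^+ 2.
Let g := \int[P]_x (A x * B x).
Let W := \int[P]_x tail_sqr eta (B x).

Let mln : measurable_fun setT (fun x => ln (1 + B x)).
Proof.
by apply: (measurableT_comp (@measurable_ln R)); exact: measurable_funD.
Qed.

Lemma rintegrable_of_sqr : rintegrable P A.
Proof.
apply: (rintegrable_dom mA (g := fun x => 1 + A x ^+ 2)).
  by apply: rintegrableD => //; exact: rintegrable_cst.
move=> x; rewrite -(real_normK (num_real (A x))).
by have := normr_ge0 (A x); nra.
Qed.

Lemma rintegrableM_of_sqr : rintegrable P (fun x => A x * B x).
Proof.
apply: (rintegrable_dom _ (g := fun x => A x ^+ 2 + B x ^+ 2)).
- exact: measurable_funM.
- exact: rintegrableD.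
move=> x; rewrite normrM; have := ler_absM (A x) (B x) ltr01.
by rewrite mul1r divr1.
Qed.

Lemma rintegrable_tail : rintegrable P (fun x => tail_sqr eta (B x)).
Proof.
apply: rintegrable_dom B2 _.
  apply: measurable_funM; first exact: measurable_funX.
  rewrite (_ : (fun _ => _) = \1_(B @^-1` `]eta, +oo[)).
    apply: measurable_indic; rewrite -[X in measurable X]setTI.
    exact: mB.
  apply/funext => x; rewrite indicE; congr (_%:R); congr nat_of_bool.
  by apply/idP/idP; rewrite inE /= in_itv/= andbT.
move=> x; rewrite ger0_norm ?tail_sqr_ge0//.
by rewrite ler_piMr ?sqr_ge0//; case: ltP.
Qed.

(** This makes [g] small, whereas [norm_cov_le2] makes it summable over the coordinates; terms
    quadratic in [g] need one bound of each kind. *)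
Lemma norm_cov_le : `|g| <= eta * (1 + a) + W / eta.
Proof.
pose G x := eta * (1 + A x ^+ 2) + eta^-1 * tail_sqr eta (B x).
have Gi1 : rintegrable P (fun x => eta * (1 + A x ^+ 2)).
  by apply: rintegrableZ; apply: rintegrableD => //; exact: rintegrable_cst.
have Gi2 : rintegrable P (fun x => eta^-1 * tail_sqr eta (B x)).
  by apply: rintegrableZ; exact: rintegrable_tail.
have -> : eta * (1 + a) + W / eta = \int[P]_x G x.
  rewrite RintegralD// !RintegralZl//; last 2 first.
  - exact: rintegrable_tail.
  - by apply: rintegrableD => //; exact: rintegrable_cst.
  rewrite RintegralD//; last exact: rintegrable_cst.
  by rewrite Rintegral_prob_cst [_^-1 * _]mulrC.
apply: ler_norm_Rintegral.
- exact: measurable_funM.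
- exact: rintegrableD.
- by move=> x; rewrite /G [_^-1 * _]mulrC absM_le_tail.
Qed.

Lemma norm_cov_le2 : `|g| <= a + b.
Proof.
rewrite -[leRHS]RintegralD//; apply: ler_norm_Rintegral.
- exact: measurable_funM.
- exact: rintegrableD.
move=> x; rewrite normrM; have := ler_absM (A x) (B x) ltr01.
by rewrite mul1r divr1.
Qed.

(* First-order expansion of [h] in [B] under the density [1 + A]: the linear
   terms are [h'(s) E(A B)] on one side and [g h'(s)] on the other. *)
Lemma coordinate_swap C h h' s : 0 < C -> smooth_test C h h' ->
  `|\int[Q]_x h (s + ln (1 + B x)) - \int[P]_x h (s + (g + ln (1 + B x)))| <=
  6 * C * (eta * a + eta * b + W / eta) + 2 * C * `|g| * (`|g| + eta + W / eta).
Proof.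
move=> C0 [mh h01 [h'C hL hT h'L]]; have C00 := ltW C0.
have i0 : 0 < eta^-1 by rewrite invr_gt0.
pose Y x := ln (1 + B x).
have mhY (r : R) : measurable_fun setT (fun x => h (r + Y x)).
  by apply: (measurableT_comp mh); exact: measurable_funD.
have Ai := rintegrable_of_sqr; have ABi := rintegrableM_of_sqr.
have Di := rintegrable_tail.
have hi (r : R) : rintegrable P (fun x => h (r + Y x)).
  by apply: integrable_itv01 => // x; exact: h01.
have mhA : measurable_fun setT (fun x => h (s + Y x) * (1 + A x)).
  by apply: measurable_funM => //; exact: measurable_funD.
have hAi : rintegrable P (fun x => h (s + Y x) * (1 + A x)).
  apply: (rintegrable_dom mhA (g := fun x => 1 + `|A x|)).
    by apply: rintegrableD; [exact: rintegrable_cst|exact: integrable_norm].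
  move=> x; have /andP[u0 u1] := h01 (s + Y x); rewrite normrM (ger0_norm u0).
  apply: (@le_trans _ _ `|1 + A x|); first by rewrite ler_piMl.
  by rewrite (le_trans (ler_normD _ _))// normr1.
(* The subtracted bracket has integral [0], as [E A = 0] and [E (A B) = g]. Subtracting it cancels
   the first-order terms pointwise, so that [F] can be bounded in absolute value. *)
pose F x := h (s + Y x) * (1 + A x) - h (s + g + Y x)
  - (h s * A x + h' s * (A x * B x - g)).
have ABgi : rintegrable P (fun x => A x * B x - g).
  by apply: rintegrableB => //; exact: rintegrable_cst.
have Li : rintegrable P (fun x => h s * A x + h' s * (A x * B x - g)).
  by apply: rintegrableD; exact: rintegrableZ.
have hgi := hi (s + g).
have -> : \int[Q]_x h (s + ln (1 + B x)) - \int[P]_x h (s + (g + ln (1 + B x))) =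
    \int[P]_x F x.
  rewrite (QP (mhY s)); last by move=> x; exact: h01.
  rewrite RintegralB//; last exact: rintegrableB.
  rewrite RintegralB//.
  rewrite RintegralD//; [|exact: rintegrableZ..].
  rewrite !RintegralZl// EA RintegralB//; last exact: rintegrable_cst.
  rewrite Rintegral_prob_cst subrr !mulr0 addr0 subr0.
  by congr (_ - _); apply: eq_Rintegral => x _; rewrite addrA.
pose G x := 6 * C * (eta * A x ^+ 2 + eta * B x ^+ 2 + eta^-1 * tail_sqr eta (B x))
  + 2 * C * `|g| * ((`|g| + eta) + eta^-1 * tail_sqr eta (B x)).
have Gi1 : rintegrable P (fun x => eta * A x ^+ 2 + eta * B x ^+ 2).
  by apply: rintegrableD; exact: rintegrableZ.
have Gi2 : rintegrable P (fun x => eta^-1 * tail_sqr eta (B x)).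
  exact: rintegrableZ.
have Gi3 : rintegrable P (fun=> `|g| + eta) by exact: rintegrable_cst.
have GE : 6 * C * (eta * a + eta * b + W / eta)
    + 2 * C * `|g| * (`|g| + eta + W / eta) = \int[P]_x G x.
  rewrite RintegralD//; [|by apply: rintegrableZ; apply: rintegrableD..].
  rewrite !RintegralZl//; [|by apply: rintegrableD..].
  rewrite [X in _ = 6 * C * X + _]RintegralD//.
  rewrite [X in _ = 6 * C * (X + _) + _]RintegralD//; [|exact: rintegrableZ..].
  rewrite [X in _ = _ + 2 * C * `|g| * X]RintegralD// !RintegralZl//.
  rewrite Rintegral_prob_cst.
  by rewrite ![_^-1 * _]mulrC.
apply: (@le_trans _ _ (\int[P]_x G x)); last by rewrite -GE.
apply: ler_norm_Rintegral.
- apply: measurable_funB; last exact: rintegrable_measurable Li.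
  exact: measurable_funB.
- by apply: rintegrableD; apply: rintegrableZ; exact: rintegrableD.
move=> x; have [Y1 Y2] := ln1p_dist (B12 x).
(* Three remainders: the expansion in [B], weighted by [A]; the expansion in the shift [g] at
   [s + Y x]; the change of slope between [s] and [s + Y x]. *)
have -> : F x = A x * (h (s + Y x) - h s - B x * h' s) -
    ((h (s + Y x + g) - h (s + Y x) - g * h' (s + Y x))
     + g * (h' (s + Y x) - h' s)).
  by rewrite /F (addrAC s g); ring.
have C60 : 0 < 6 * C by rewrite mulr_gt0.
apply: (le_trans (ler_normB _ _)); apply: lerD.
  rewrite normrM; set M := `|h (s + Y x) - h s - B x * h' s|.
  have M1 : M <= 6 * C * `|B x|.
    have t1 : `|B x * h' s| <= C * `|B x| by rewrite normrM mulrC ler_wpM2r.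
    have t2 := hL s (Y x); have : C * `|Y x| <= C * (2 * `|B x|).
      exact: ler_wpM2l.
    have := mulr_ge0 (ltW C0) (normr_ge0 (B x)).
    have := ler_normB (h (s + Y x) - h s) (B x * h' s); rewrite -/M; lra.
  (* Here [6 = 4 + 2]: the Taylor remainder in [Y x] with [Y^2 <= 4 B^2], and the cost [2 B^2] of
     replacing [Y x] by [B x] in the linear term. *)
  have M2 : M <= 6 * C * B x ^+ 2.
    have -> : M = `|(h (s + Y x) - h s - Y x * h' s) + (Y x - B x) * h' s|.
      by congr `|_|; ring.
    apply: (le_trans (ler_normD _ _)); rewrite normrM.
    have t1 : `|Y x - B x| * `|h' s| <= 2 * B x ^+ 2 * C by rewrite ler_pM.
    have t2 := hT s (Y x).
    have t3 : Y x ^+ 2 <= 4 * B x ^+ 2.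
      rewrite -(real_normK (num_real (Y x))) -(real_normK (num_real (B x))).
      by have := normr_ge0 (Y x); have := normr_ge0 (B x); rewrite -/(Y x) in Y1; nra.
    have : C * Y x ^+ 2 <= C * (4 * B x ^+ 2) by exact: ler_wpM2l.
    lra.
  have := @taylor_le_tail _ eta (A x) (B x) (M / (6 * C)) eta0 (Beta x).
  rewrite !ler_pdivrMr// [`|B x| * _]mulrC [B x ^+ 2 * _]mulrC => /(_ M1 M2).
  by rewrite mulrA ler_pdivrMr// [_ * (6 * C)]mulrC [_^-1 * _]mulrC.
apply: (le_trans (ler_normD _ _)); rewrite normrM.
have t1 := hT (s + Y x) g.
have t2 : `|h' (s + Y x) - h' s| <= C * (2 * `|B x|).
  apply: le_trans (h'L s (Y x)) _; exact: ler_wpM2l.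
have t3 := abs_le_tail eta0 (Beta x).
have g0 := normr_ge0 g.
have t4 : C * (2 * `|B x|) <= C * (2 * (eta + tail_sqr eta (B x) / eta)).
  by rewrite !ler_wpM2l.
have t5 : `|g| * `|h' (s + Y x) - h' s| <=
    `|g| * (C * (2 * (eta + tail_sqr eta (B x) / eta))).
  by apply: ler_wpM2l => //; exact: le_trans t2 t4.
rewrite -(real_normK (num_real g)) in t1.
have t6 : 0 <= C * `|g| ^+ 2 by rewrite mulr_ge0 ?sqr_ge0.
rewrite [_^-1 * _]mulrC; move: t1 t5; set q := tail_sqr _ _ / _; lra.
Qed.

End coordinate_swap.

(** * Fixed sample size *)

Lemma Rintegral_sum d (T : measurableType d) (R : realType)
    (P : probability T R) n (f : 'I_n -> T -> R) :
  (forall i, rintegrable P (f i)) ->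
  rintegrable P (fun x => \sum_(i < n) f i x) /\
  \int[P]_x \sum_(i < n) f i x = \sum_(i < n) \int[P]_x f i x.
Proof.
elim: n => [|n IH] in f * => fi.
  split.
    rewrite (_ : (fun _ => _) = fun=> 0); first exact: rintegrable_cst.
    by apply/funext => x; rewrite big_ord0.
  by under eq_Rintegral do rewrite big_ord0; rewrite big_ord0 Rintegral_prob_cst.
have [si sE] := IH (fun i => f (lift ord0 i)) (fun i => fi _).
split.
  rewrite (_ : (fun _ => _) =
      fun x => f ord0 x + \sum_(i < n) f (lift ord0 i) x).
    exact: rintegrableD.
  by apply/funext => x; rewrite big_ord_recl.
under eq_Rintegral do rewrite big_ord_recl.
have fi0 := fi ord0.
by rewrite RintegralD// sE big_ord_recl.
Qed.

Lemma Rintegral_product_probability (R : realType) n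
    (d : 'I_n -> measure_display) (X : forall i, measurableType (d i))
    (P : forall i, probability (X i) R) (g : forall i, X i -> R) :
  (forall i, rintegrable (P i) (g i)) -> (forall i x, 0 <= g i x) ->
  rintegrable (product_probability P) (fun y => \prod_(i < n) g i (y i)) /\
  \int[product_probability P]_y \prod_(i < n) g i (y i) =
  \prod_(i < n) \int[P i]_x g i x.
Proof.
move=> gi g0.
have mg i := rintegrable_measurable (gi i).
have E : (\int[product_probability P]_y (\prod_(i < n) g i (y i))%:E =
    (\prod_(i < n) \int[P i]_x g i x)%:E)%E.
  rewrite integral_product_probability//.
  rewrite (big_morph (@EFin R) (id1 := 1%E) (op1 := *%E))//.
  by apply: eq_bigr => i _; apply/esym/EFin_Rintegral; exact: gi.
split; last by rewrite /Rintegral E.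
apply/integrableP; split.
  apply/measurable_EFinP; apply: measurable_prod => i _.
  exact: (measurableT_comp (mg i) (measurable_coord X i)).
under eq_integral => y _.
  rewrite /= ger0_norm; last by apply: prodr_ge0 => i _; exact: g0.
  over.
by rewrite E ltry.
Qed.

Section product_model.
Context (R : realType) n (d : 'I_n -> measure_display)
  (X : forall i, measurableType (d i)) (P Q : forall i, probability (X i) R).
Variables (A B : forall i, X i -> R).
Arguments A : clear implicits.
Arguments B : clear implicits.
Hypotheses (mA : forall i, measurable_fun setT (A i))
  (mB : forall i, measurable_fun setT (B i)).
Hypotheses (A2 : forall i, rintegrable (P i) (fun x => A i x ^+ 2))
  (B2 : forall i, rintegrable (P i) (fun x => B i x ^+ 2)).
Hypotheses (EA : forall i, \int[P i]_x A i x = 0)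
  (EB : forall i, \int[P i]_x B i x = 0).
Hypothesis B12 : forall i x, - (1 / 2) <= B i x.
Arguments B12 : clear implicits.
Hypothesis QP : forall i (f : X i -> R), measurable_fun setT f ->
  (forall x, 0 <= f x <= 1) -> \int[Q i]_x f x = \int[P i]_x (f x * (1 + A i x)).

Definition log_lr (y : product_space X) := \sum_(i < n) ln (1 + B i (y i)).

Definition cov_AB := \sum_(i < n) \int[P i]_x (A i x * B i x).

Definition tail_sum eta := \sum_(i < n) \int[P i]_x tail_sqr eta (B i x).

Let mln i : measurable_fun setT (fun x => ln (1 + B i x)).
Proof.
by apply: (measurableT_comp (@measurable_ln R)); exact: measurable_funD.
Qed.

Lemma measurable_log_lr : measurable_fun setT log_lr.
Proof.
rewrite (_ : log_lr = fun y => 0 + log_lr y).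
  exact: (measurable_sum_coord 0 mln).
by apply/funext => y; rewrite add0r.
Qed.

(** The errors linear in the second moments add up to [eta * S] plus the tail term; those quadratic
    in the covariances are at most their largest modulus times their total [S]. For fixed [C] and
    [S] the bound is small once [eta] is small and [tail_sum eta] is small compared with [eta]. *)
Lemma product_model_swap eta C h h' S :
  0 < eta -> 0 < C -> smooth_test C h h' ->
  (forall i x, - eta <= B i x) ->
  \sum_(i < n) (\int[P i]_x A i x ^+ 2 + \int[P i]_x B i x ^+ 2) <= S ->
  `|\int[product_probability Q]_y h (log_lr y) -
    \int[product_probability P]_y h (cov_AB + log_lr y)| <=
  (6 * C * (S + 1) + 2 * C * S * (S + 2)) * (eta + tail_sum eta / eta).
Proof.
move=> eta0 C0 hh Beta SS; have C00 := ltW C0.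
pose a i := \int[P i]_x A i x ^+ 2; pose b i := \int[P i]_x B i x ^+ 2.
pose g i := \int[P i]_x (A i x * B i x).
pose W i := \int[P i]_x tail_sqr eta (B i x).
have [mh h01 _] := hh.
have a0 i : 0 <= a i by apply: Rintegral_ge0 => x _; exact: sqr_ge0.
have b0 i : 0 <= b i by apply: Rintegral_ge0 => x _; exact: sqr_ge0.
have W0 i : 0 <= W i by apply: Rintegral_ge0 => x _; exact: tail_sqr_ge0.
have i0 : 0 < eta^-1 by rewrite invr_gt0.
have w0 : 0 <= tail_sum eta / eta 
  by rewrite mulr_ge0 ?(ltW i0)//; apply: sumr_ge0 => i _; exact: W0.
have S0 : 0 <= S.
  by apply: le_trans SS; apply: sumr_ge0 => i _; rewrite addr_ge0// ?a0 ?b0.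
pose e i := 6 * C * (eta * a i + eta * b i + W i / eta)
  + 2 * C * `|g i| * (`|g i| + eta + W i / eta).
(* The roles of the two families are exchanged here, and the noise side carries the shift [g i] in
   its [i]-th summand, so that the shifts add up to [cov_AB]. *)
have := @product_swap R n d X Q P (fun i x => ln (1 + B i x))
  (fun i x => g i + ln (1 + B i x)) h e mln _ mh h01 _ 0.
have -> : \int[product_probability P]_y
      h (0 + \sum_(i < n) (g i + ln (1 + B i (y i)))) =
    \int[product_probability P]_y h (cov_AB + log_lr y).
  by apply: eq_Rintegral => y _; rewrite add0r big_split.
have -> : \int[product_probability Q]_y h (0 + \sum_(i < n) ln (1 + B i (y i))) =
    \int[product_probability Q]_y h (log_lr y).
  by apply: eq_Rintegral => y _; rewrite add0r.
move=> /(_ _ _)/le_trans; apply.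
- by move=> i; exact: measurable_funD.
- by move=> i s; exact: coordinate_swap (QP (i := i)) _ _ _ s C0 hh.
have Wle i : W i <= tail_sum eta.
  rewrite /tail_sum (bigD1 i)//= lerDl; apply: sumr_ge0 => j _; exact: W0.
have ale i : a i <= S.
  apply: le_trans SS; rewrite (bigD1 i)//= -/(a i) -addrA lerDl addr_ge0 ?b0//.
  by apply: sumr_ge0 => j _; rewrite addr_ge0// ?a0 ?b0.
pose q := tail_sum eta / eta.
have Wq i : W i / eta <= q by rewrite ler_wpM2r// ltW.
have gS : \sum_(i < n) `|g i| <= S.
  apply: le_trans SS; apply: ler_sum => i _; exact: norm_cov_le2.
have gG i : `|g i| <= eta * (1 + S) + q.
  have t : `|g i| <= eta * (1 + a i) + W i / eta by exact: norm_cov_le.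
  apply: (le_trans t).
  by apply: lerD => //; rewrite ler_wpM2l ?(ltW eta0)// lerD2l.
apply: (@le_trans _ _ (6 * C * (eta * S + q)
    + 2 * C * S * ((eta * (1 + S) + q) + eta + q))).
  rewrite /e big_split/=; apply: lerD.
    rewrite -mulr_sumr ler_wpM2l ?mulr_ge0// big_split/= lerD//; last first.
      by rewrite -mulr_suml.
    by under eq_bigr do rewrite -mulrDr; rewrite -mulr_sumr ler_wpM2l// ltW.
  apply: (@le_trans _ _ (\sum_(i < n)
      `|g i| * (2 * C * (eta * (1 + S) + q + eta + q)))).
    apply: ler_sum => i _; rewrite mulrAC mulrC ler_wpM2l//.
    by rewrite ler_wpM2l ?mulr_ge0// lerD// lerD2r.
  rewrite -mulr_suml -!mulrA [2 * (C * (S * _))]mulrCA.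
  rewrite (_ : C * (2 * (S * _)) = S * (2 * (C * (eta * (1 + S) + q + eta + q)))); last by ring.
  rewrite ler_wpM2r// !mulr_ge0// !addr_ge0// ?(ltW eta0)//.
  by rewrite mulr_ge0 ?(ltW eta0)// addr_ge0.
rewrite -/q; have := w0; rewrite -/q => q0.
have := mulr_ge0 C00 q0; have := mulr_ge0 C00 (ltW eta0).
have := mulr_ge0 (mulr_ge0 C00 q0) (mulr_ge0 S0 S0).
have := mulr_ge0 (mulr_ge0 C00 q0) S0.
lra.
Qed.

(* The Hellinger affinity [E exp(L/2)] factorizes; the staircase bounds it from
   above by tail probabilities of [L], as [E exp(L) = 1]. *)
Lemma hellinger_tail_bound e eta delta K :
  0 <= e <= 1 / 2 -> 0 < eta -> 0 < delta -> (forall i x, - e <= B i x) ->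
  expR (- ((1 + 2 * e) * ((1 + 2 * e) / 8 * \sum_(i < n) \int[P i]_x B i x ^+ 2
                          - hellinger_gap eta * tail_sum eta))) <=
  delta + \sum_(k < K.+1) delta * fine (product_probability P
    [set y | 2 * ln (k.+1%:R * delta) < log_lr y]) + (K.+1%:R * delta)^-1.
Proof.
move=> e01 eta0 d0 Be.
have Bi i : rintegrable (P i) (B i) by exact: rintegrable_of_sqr.
have Di i : rintegrable (P i) (fun x => tail_sqr eta (B i x)).
  exact: rintegrable_tail.
pose r i x := Num.sqrt (1 + B i x).
have r0 i x : 0 <= r i x by exact: sqrtr_ge0.
have rr i x : r i x ^+ 2 = 1 + B i x.
  by rewrite sqr_sqrtr//; have := B12 i x; lra.
have mr i : measurable_fun setT (r i).
  apply: (measurableT_comp (continuous_measurable_fun (@sqrt_continuous R))).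
  exact: measurable_funD.
have r2i i : rintegrable (P i) (fun x => r i x ^+ 2).
  rewrite (_ : (fun _ => _) = fun x => 1 + B i x); last exact/funext.
  by apply: rintegrableD => //; exact: rintegrable_cst.
have ri i : rintegrable (P i) (r i) by exact: rintegrable_of_sqr.
have r2E i : \int[P i]_x r i x ^+ 2 = 1.
  rewrite (@eq_Rintegral _ _ _ (P i) setT (fun x => 1 + B i x)); last by move=> x _.
  have c1 : rintegrable (P i) (fun=> 1) by exact: rintegrable_cst.
  have Bii := Bi i.
  by rewrite RintegralD// EB Rintegral_prob_cst addr0.
(* One minus the affinity of the [i]-th coordinate. Since [E B = 0], it is also the expectation of
   [hellinger (B i)]. *)
pose u i := 1 - \int[P i]_x r i x.
have hi i : rintegrable (P i) (fun x => hellinger (B i x)).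
  rewrite (_ : (fun _ => _) = fun x => 2^-1 * B i x - (r i x - 1)).
    apply: rintegrableB; first exact: rintegrableZ.
    by apply: rintegrableB => //; exact: rintegrable_cst.
  apply/funext => x; rewrite hellingerE; last by have := B12 i x; lra.
  by rewrite mulrC.
have uE i : u i = \int[P i]_x hellinger (B i x).
  rewrite (@eq_Rintegral _ _ _ (P i) setT (fun x => 2^-1 * B i x - (r i x - 1))); last first.
    move=> x _; rewrite hellingerE; last by have := B12 i x; lra.
    by rewrite mulrC.
  have c1 : rintegrable (P i) (fun=> 1) by exact: rintegrable_cst.
  have Bii := Bi i; have rii := ri i.
  rewrite RintegralB//; [|exact: rintegrableZ|exact: rintegrableB].
  rewrite RintegralZl// EB mulr0 RintegralB// Rintegral_prob_cst.
  by rewrite sub0r opprB.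
have u0e i : 0 <= u i <= e.
  apply/andP; split.
    rewrite uE; apply: Rintegral_ge0 => x _.
    by rewrite /hellinger divr_ge0// sqr_ge0.
  rewrite /u lerBlDr -lerBlDl -[leLHS](Rintegral_prob_cst (P i)).
  apply: ler_Rintegral => //; first exact: rintegrable_cst.
  by move=> x; exact: sqrt1p_ge.
have usum : hellinger_gap eta * tail_sum eta <=
    (1 + 2 * e) / 8 * (\sum_(i < n) \int[P i]_x B i x ^+ 2) - \sum_(i < n) u i.
  rewrite !mulr_sumr -sumrB; apply: ler_sum => i _.
  have Dii := Di i; have B2i := B2 i; have hii := hi i.
  rewrite -!RintegralZl// uE -RintegralB//; last exact: rintegrableZ.
  apply: ler_Rintegral; first exact: rintegrableZ.
    by apply: rintegrableB => //; exact: rintegrableZ.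
  by move=> x; exact: hellinger_le.
pose w (y : product_space X) := \prod_(i < n) r i (y i).
have [wi wE] := Rintegral_product_probability ri r0.
have [w2i w2E] := Rintegral_product_probability r2i (fun i x => sqr_ge0 (r i x)).
have wsq y : \prod_(i < n) r i (y i) ^+ 2 = w y ^+ 2 by rewrite prodrXl.
have {}w2i : rintegrable (product_probability P) (fun y => w y ^+ 2).
  by rewrite (_ : (fun _ => _) = fun y : product_space X =>
    \prod_(i < n) r i (y i) ^+ 2)//; apply/funext => y; rewrite wsq.
have {}w2E : \int[product_probability P]_y w y ^+ 2 = 1.
  rewrite -(@eq_Rintegral _ _ _ _ _ (fun y => w y ^+ 2) _ (fun y _ => wsq y)).
  by rewrite w2E big1.
have w_exp y : w y = expR (log_lr y / 2).
  rewrite /log_lr mulr_suml expR_sum; apply: eq_bigr => i _.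
  have b0 : 0 < 1 + B i (y i) by have := B12 i (y i); lra.
  rewrite /r -[X in Num.sqrt X](lnK b0) -[X in expR X](divfK (x := 2))//.
  by rewrite mulr_natr mulr2n expRD -expr2 sqrtr_sqr gtr0_norm// expR_gt0.
have lt_w k y : (k.+1%:R * delta < w y) = (2 * ln (k.+1%:R * delta) < log_lr y).
  have kd : 0 < k.+1%:R * delta by rewrite mulr_gt0.
  rewrite w_exp -[X in X < _]lnK ?posrE// ltr_expR ltr_pdivlMr//.
  by rewrite mulrC.
pose I (k : nat) : set (product_space X) :=
  [set y | 2 * ln (k.+1%:R * delta) < log_lr y].
have mI k : measurable (I k).
  rewrite (_ : I k = log_lr @^-1` `]2 * ln (k.+1%:R * delta), +oo[).
    by rewrite -[X in measurable X]setTI; exact: measurable_log_lr.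
  by apply/seteqP; split => y /=; rewrite in_itv/= andbT.
have Ii k : rintegrable (product_probability P) (\1_(I k)).
  apply: integrable_itv01; first exact: measurable_indic.
  by move=> y; rewrite indicE; case: (_ \in _); rewrite ?lexx ler01.
have IE k y : (k.+1%:R * delta < w y)%R%:R = \1_(I k) y :> R.
  rewrite indicE lt_w; congr (_%:R); congr nat_of_bool.
  by apply/idP/idP; rewrite inE.
have [si sE] := @Rintegral_sum _ _ _ (product_probability P) K.+1
  (fun (k : 'I_K.+1) y => delta * \1_(I k) y) (fun k => rintegrableZ delta (Ii k)).
have c0 : 0 <= (K.+1%:R * delta)^-1 by rewrite invr_ge0 mulr_ge0// ltW.
(* The affinity [E w], with [w = exp(L/2)], lies in between: below it by factorization and
   [expR_le_1B], above it by [staircase_ge], whose last term is controlled by [E w^2 = 1]. *)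
apply: (@le_trans _ _ (\int[product_probability P]_y w y)).
  rewrite wE; apply: (@le_trans _ _ (expR (- ((1 + 2 * e) * \sum_(i < n) u i)))).
    rewrite ler_expR lerN2 ler_wpM2l//; first by case/andP: e01 => *; lra.
    by have := usum; lra.
  rewrite mulr_sumr -sumrN expR_sum; apply: ler_prod => i _.
  rewrite expR_ge0 /= (le_trans (expR_le_1B e01 (u0e i)))// /u; lra.
have ci : rintegrable (product_probability P) (fun=> delta).
  exact: rintegrable_cst.
have w2ci := rintegrableZ (K.+1%:R * delta)^-1 w2i.
have -> : delta + \sum_(k < K.+1) delta * fine (product_probability P (I k))
    + (K.+1%:R * delta)^-1 = \int[product_probability P]_y
    (delta + (\sum_(k < K.+1) delta * \1_(I k) y) + (K.+1%:R * delta)^-1 * w y ^+ 2).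
  rewrite RintegralD//; last exact: rintegrableD.
  rewrite RintegralD// Rintegral_prob_cst RintegralZl// w2E mulr1 sE.
  congr (_ + _ + _); apply: eq_bigr => k _; have Iik := Ii k.
  rewrite RintegralZl//.
  by rewrite /Rintegral integral_indic// setIT.
apply: ler_Rintegral => //.
  by apply: rintegrableD => //; exact: rintegrableD.
move=> y; have w0 : 0 <= w y by rewrite w_exp expR_ge0.
apply: (le_trans (staircase_ge K d0 w0)).
by rewrite lerD ?[_^-1 * _]mulrC// lerD2l; apply: ler_sum => k _; rewrite IE.
Qed.

End product_model.

(** * Limits *)

Lemma near_dist_le (R : realType) (u : nat -> R) (l e : R) :
  u n @[n --> \oo] --> l -> 0 < e -> \forall n \near \oo, `|u n - l| <= e.
Proof.
move=> ul e0; near=> n; rewrite distrC; near: n.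
by move/cvgrPdist_le: ul => /(_ e e0).
Unshelve. all: by end_near. Qed.

(* The Hellinger affinities force Lindeberg's condition: a surviving tail of
   the likelihood ratios would make [E exp(L/2)] exceed its Gaussian limit. *)
Lemma tail_sum_cvg0 (R : realType) (s eta : R) (V e tau : nat -> R)
    (prob_gt : nat -> R -> R) :
  0 < s -> 0 < eta ->
  V n @[n --> \oo] --> s ^+ 2 -> e n @[n --> \oo] --> 0 ->
  (forall n, 0 <= e n) -> (forall n, 0 <= tau n) ->
  (forall x, prob_gt n x @[n --> \oo] --> 1 - normal_cdf ((x + s ^+ 2 / 2) / s)) ->
  (\forall n \near \oo, forall delta K, 0 < delta ->
    expR (- ((1 + 2 * e n) * ((1 + 2 * e n) / 8 * V n
                              - hellinger_gap eta * tau n))) <=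
    delta + \sum_(k < K.+1) delta * prob_gt n (2 * ln (k.+1%:R * delta))
    + (K.+1%:R * delta)^-1) ->
  tau n @[n --> \oo] --> 0.
Proof.
move=> s0 eta0 Vs e_0 e0 tau0 Fcvg bound.
have gap0 := hellinger_gap_gt0 eta0.
apply/cvgrPdist_le => z z0.
(* A tail sum above [z] would raise the exponent by more than [2 * kappa]; one [kappa] is spent on
   the convergence of [V], the other on the errors of the staircase. *)
pose kappa := hellinger_gap eta * z / 2.
have kappa0 : 0 < kappa by rewrite divr_gt0// mulr_gt0.
(* Three errors of size [rho] (mesh, cap, convergence of the tail probabilities) raise [exp(-s^2/8)]
   exactly to [exp(-s^2/8 + kappa)]. *)
pose rho := expR (- (s ^+ 2 / 8)) * (expR kappa - 1) / 3.
have rho0 : 0 < rho.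
  by rewrite divr_gt0// mulr_gt0 ?expR_gt0// subr_gt0 expR_gt1.
(* With mesh [rho], [K.+1 >= rho^-2] steps bring the cap error [1 / (K.+1 * rho)] down to [rho]. *)
pose K := Num.truncn (rho^-1 ^+ 2).
have Krho : (K.+1%:R * rho)^-1 <= rho.
  have i0 : 0 < rho^-1 by rewrite invr_gt0.
  have Kr0 : 0 < K.+1%:R * rho by apply: mulr_gt0.
  rewrite -[leRHS]invrK lef_pV2 ?posrE//.
  have : rho^-1 ^+ 2 <= K.+1%:R by rewrite ltW// truncnS_gt.
  by rewrite -(ler_pM2r rho0) expr2 mulfVK ?gt_eqF.
have sumcvg : \sum_(k < K.+1) rho * prob_gt n (2 * ln (k.+1%:R * rho)) @[n --> \oo] -->
    \sum_(k < K.+1) rho *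
    (1 - normal_cdf ((2 * ln (k.+1%:R * rho) + s ^+ 2 / 2) / s)).
  apply: cvg_big => [|k _]; first exact: add_continuous.
  by apply: cvgM; [exact: cvg_cst|exact: Fcvg].
have Vcvg : (1 + 2 * e n) ^+ 2 / 8 * V n @[n --> \oo] --> s ^+ 2 / 8.
  have c1 : 1 + 2 * e n @[n --> \oo] --> 1 + 2 * (0 : R).
    by apply: cvgD; [exact: cvg_cst|apply: cvgM => //; exact: cvg_cst].
  rewrite (_ : s ^+ 2 / 8 = (1 + 2 * 0) ^+ 2 / 8 * s ^+ 2); last by field.
  apply: cvgM => //; apply: cvgM; last exact: cvg_cst.
  by rewrite expr2; under eq_cvg do rewrite expr2; exact: cvgM.
pose S' := \sum_(k < K.+1) rho *
  (1 - normal_cdf ((2 * ln (k.+1%:R * rho) + s ^+ 2 / 2) / s)).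
have stair : S' <= expR (- (s ^+ 2 / 8)) by exact: staircase_normal.
near=> n; rewrite sub0r normrN ger0_norm//.
have B : forall delta K, 0 < delta ->
    expR (- ((1 + 2 * e n) * ((1 + 2 * e n) / 8 * V n
                              - hellinger_gap eta * tau n))) <=
    delta + \sum_(k < K.+1) delta * prob_gt n (2 * ln (k.+1%:R * delta))
    + (K.+1%:R * delta)^-1 by near: n.
pose S := \sum_(k < K.+1) rho * prob_gt n (2 * ln (k.+1%:R * rho)).
have n1 : `|S - S'| <= rho by rewrite /S; near: n; exact: near_dist_le sumcvg rho0.
have n2 : `|(1 + 2 * e n) ^+ 2 / 8 * V n - s ^+ 2 / 8| <= kappa.
  by near: n; exact: near_dist_le Vcvg kappa0.
have {}B := B rho K rho0.
have : expR (- ((1 + 2 * e n) * ((1 + 2 * e n) / 8 * V n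
                              - hellinger_gap eta * tau n))) <=
    expR (- (s ^+ 2 / 8) + kappa).
  have Sle : S <= expR (- (s ^+ 2 / 8)) + rho.
    move: n1; rewrite ler_norml lerBlDr => /andP[_ n1].
    by apply: (le_trans n1); rewrite addrC lerD2r.
  rewrite expRD (_ : _ * expR kappa =
      rho + (expR (- (s ^+ 2 / 8)) + rho) + rho); last by rewrite /rho; field.
  by apply: (le_trans B); rewrite !lerD.
rewrite ler_expR => ineq.
have en := e0 n; have tn := tau0 n.
have gt : 0 <= hellinger_gap eta * tau n by rewrite mulr_ge0// ltW.
have egt := mulr_ge0 en gt.
have : hellinger_gap eta * tau n <= hellinger_gap eta * z.
  move: n2; rewrite ler_norml => /andP[_ n2].
  have k2 : hellinger_gap eta * z = 2 * kappa by rewrite /kappa; field.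
  by nra.
by rewrite ler_pM2l.
Unshelve. all: by end_near. Qed.

Section power_limit.
Context (R : realType) (d : nat -> measure_display)
  (Om : forall n, measurableType (d n)) (P Q : forall n, probability (Om n) R)
  (L : forall n, Om n -> R).
Arguments L : clear implicits.
Variables (Gam c : nat -> R) (gam m s u : R).
Hypothesis mL : forall n, measurable_fun setT (L n).
Hypothesis s0 : 0 < s.
Hypothesis Lcvg : forall x,
  fine (P n [set w | x < L n w]) @[n --> \oo] --> 1 - normal_cdf ((x - m) / s).
Arguments Lcvg : clear implicits.
Hypothesis Gcvg : Gam n @[n --> \oo] --> gam.
Hypothesis swap : forall C zeta, 0 < C -> 0 < zeta -> \forall n \near \oo,
  forall h h', smooth_test C h h' ->
    `|\int[Q n]_w h (L n w) - \int[P n]_w h (Gam n + L n w)| <= zeta.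
Hypothesis level :
  fine (P n [set w | c n < L n w]) @[n --> \oo] --> normal_cdf u.

Let measurable_gt n x : measurable [set w | x < L n w].
Proof.
rewrite (_ : [set w | _] = L n @^-1` `]x, +oo[).
  by rewrite -[X in measurable X]setTI; exact: mL.
by apply/seteqP; split => w /=; rewrite in_itv/= andbT.
Qed.

Let prob_gtE (p : forall n, probability (Om n) R) n x :
  fine (p n [set w | x < L n w]) = \int[p n]_w (x < L n w)%R%:R.
Proof.
rewrite -[LHS](_ : \int[p n]_w \1_[set w | x < L n w] w = _).
  apply: eq_Rintegral => w _; rewrite indicE; congr (_%:R); congr nat_of_bool.
  by apply/idP/idP; rewrite inE.
by rewrite /Rintegral integral_indic ?setIT.
Qed.

Let rintegrable_gt (p : forall n, probability (Om n) R) n x :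
  rintegrable (p n) (fun w => (x < L n w)%R%:R).
Proof.
rewrite (_ : (fun _ => _) = \1_[set w | x < L n w]).
  apply: integrable_itv01; first exact: measurable_indic.
  by move=> w; rewrite indicE; case: (_ \in _); rewrite ?lexx ler01.
apply/funext => w; rewrite indicE; congr (_%:R); congr nat_of_bool.
by apply/idP/idP; rewrite inE.
Qed.

Let le_prob_gt n x y : x <= y ->
  fine (P n [set w | y < L n w]) <= fine (P n [set w | x < L n w]).
Proof.
move=> xy; rewrite !prob_gtE; apply: ler_Rintegral => // w.
by rewrite ler_nat; case: ltP => // yL; rewrite (le_lt_trans xy yL).
Qed.

(** The limiting tail probability at [m - s * u] is [normal_cdf u], and it is strictly monotone, so
    a critical value off by [delta] would put the level on the wrong side of a fixed gap. *)
Let critical_value_cvg delta : 0 < delta ->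
  \forall n \near \oo, `|c n - (m - s * u)| <= delta.
Proof.
move=> d0; set c0 := m - s * u.
have lt1 : normal_cdf u < 1 - normal_cdf ((c0 - delta - m) / s).
  rewrite -normal_cdfN; apply: normal_cdf_lt.
  rewrite (_ : - _ = u + delta / s); last by rewrite /c0; field; rewrite gt_eqF.
  by rewrite ltrDl divr_gt0.
have lt2 : 1 - normal_cdf ((c0 + delta - m) / s) < normal_cdf u.
  rewrite -normal_cdfN; apply: normal_cdf_lt.
  rewrite (_ : - _ = u - delta / s); last by rewrite /c0; field; rewrite gt_eqF.
  by rewrite ltrBlDr ltrDl divr_gt0.
(* A third of the gap: two approximation errors of this size cannot bridge it. *)
pose g1 := (1 - normal_cdf ((c0 - delta - m) / s) - normal_cdf u) / 3.
pose g2 := (normal_cdf u - (1 - normal_cdf ((c0 + delta - m) / s))) / 3.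
have g10 : 0 < g1 by rewrite divr_gt0// subr_gt0.
have g20 : 0 < g2 by rewrite divr_gt0// subr_gt0.
near=> n.
have a1 : `|fine (P n [set w | c n < L n w]) - normal_cdf u| <= g1.
  by near: n; exact: near_dist_le.
have a2 : `|fine (P n [set w | c n < L n w]) - normal_cdf u| <= g2.
  by near: n; exact: near_dist_le.
have a3 : `|fine (P n [set w | c0 - delta < L n w]) -
    (1 - normal_cdf ((c0 - delta - m) / s))| <= g1.
  by near: n; exact: near_dist_le (Lcvg _) _.
have a4 : `|fine (P n [set w | c0 + delta < L n w]) -
    (1 - normal_cdf ((c0 + delta - m) / s))| <= g2.
  by near: n; exact: near_dist_le (Lcvg _) _.
rewrite ler_distl; apply/andP; split; rewrite leNgt; apply/negP => cn.
  have := @le_prob_gt n _ _ (ltW cn).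
  by move: a1 a3 (g10); rewrite !ler_norml /g1; lra.
have := @le_prob_gt n _ _ (ltW cn).
by move: a2 a4 (g20); rewrite !ler_norml /g2; lra.
Unshelve. all: by end_near. Qed.

Lemma power_cvg :
  fine (Q n [set w | c n < L n w]) @[n --> \oo] --> normal_cdf (gam / s + u).
Proof.
apply/cvgrPdist_le => z z0; pose z3 := z / 3.
have z30 : 0 < z3 by rewrite divr_gt0.
have /cvgrPdist_le/(_ _ z30)/nbhs_ballP[r /= r0 near_cdf] :=
  @normal_cdf_continuous R (gam / s + u).
(* The threshold moves by at most [4 * delta]: one each for [c n] and [Gam n], two for the width of
   the step. The fifth part makes the inequality strict. *)
pose delta := r * s / 5.
have d0 : 0 < delta by rewrite divr_gt0// mulr_gt0.
have cdf_near t : `|t| <= 4 * delta ->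
    `|normal_cdf (gam / s + u) - normal_cdf (gam / s + u + t / s)| <= z3.
  move=> td; apply: near_cdf; rewrite /ball/= opprD addNKr normrN normrM.
  rewrite [X in _ * X]gtr0_norm ?invr_gt0// ltr_pdivrMr//.
  by apply: le_lt_trans td _; rewrite /delta; have := mulr_gt0 r0 s0; lra.
have [C C0 hC] := smooth_test_step d0.
pose c0 := m - s * u.
have low := Lcvg (c0 - gam + 4 * delta); have up := Lcvg (c0 - gam - 4 * delta).
near=> n.
have a1 : `|c n - c0| <= delta by near: n; exact: critical_value_cvg.
have a2 : `|Gam n - gam| <= delta by near: n; exact: near_dist_le.
(* Uniformity in [h] is essential, as the step used below is located by [c n] and so depends on
   [n]. *)
have a3 : forall h h', smooth_test C h h' ->
    `|\int[Q n]_w h (L n w) - \int[P n]_w h (Gam n + L n w)| <= z3.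
  by near: n; exact: swap.
have a4 : `|fine (P n [set w | c0 - gam + 4 * delta < L n w]) -
    (1 - normal_cdf ((c0 - gam + 4 * delta - m) / s))| <= z3.
  by near: n; exact: near_dist_le.
have a5 : `|fine (P n [set w | c0 - gam - 4 * delta < L n w]) -
    (1 - normal_cdf ((c0 - gam - 4 * delta - m) / s))| <= z3.
  by near: n; exact: near_dist_le.
have mh x g : measurable_fun setT (fun w => step ((g + L n w - x) / delta)).
  apply: (measurableT_comp (@measurable_step R)); apply: measurable_funM => //.
  by apply: measurable_funB => //; exact: measurable_funD.
have hi (p : forall n, probability (Om n) R) x g :
    rintegrable (p n) (fun w => step ((g + L n w - x) / delta)).
  by apply: integrable_itv01 => // w; exact: step_itv01.
have hi0 (p : forall n, probability (Om n) R) x :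
    rintegrable (p n) (fun w => step ((L n w - x) / delta)).
  by have := hi p x 0; under eq_fun do rewrite add0r.
have step_le x (t : R) : step ((t - x) / delta) <= (x < t)%R%:R.
  case: ltP => tx; first by case/andP: (step_itv01 ((t - x) / delta)).
  by rewrite step_eq0// pmulr_lle0 ?invr_gt0// subr_le0.
have step_ge x (t : R) : (x + 2 * delta < t)%R%:R <= step ((t - x) / delta).
  case: ltP => tx; last by case/andP: (step_itv01 ((t - x) / delta)).
  by rewrite step_eq1// ler_pdivlMr//; lra.
move: a1 a2; rewrite !ler_norml => /andP[a11 a12] /andP[a21 a22].
have lower : fine (P n [set w | c0 - gam + 4 * delta < L n w]) - z3 <=
    fine (Q n [set w | c n < L n w]).
  have [h' hh'] := hC (c n); have := a3 _ _ hh'; rewrite ler_norml => /andP[a31 _].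
  have l1 : \int[Q n]_w step ((L n w - c n) / delta) <=
      fine (Q n [set w | c n < L n w]).
    by rewrite prob_gtE; apply: ler_Rintegral => // w; exact: step_le.
  have l2 : fine (P n [set w | c0 - gam + 4 * delta < L n w]) <=
      \int[P n]_w step ((Gam n + L n w - c n) / delta).
    rewrite prob_gtE; apply: ler_Rintegral => // w.
    apply: le_trans (step_ge _ _); rewrite ler_nat.
    by case: ltP => // Lw; rewrite (_ : (_ < _)%R = true)//; lra.
  lra.
have upper : fine (Q n [set w | c n < L n w]) <=
    fine (P n [set w | c0 - gam - 4 * delta < L n w]) + z3.
  (* Moved left by its full width, the step equals [1] wherever the test rejects, so it dominates
     the indicator. *)
  have [h' hh'] := hC (c n - 2 * delta).
  have := a3 _ _ hh'; rewrite ler_norml => /andP[_ a32].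
  have l1 : fine (Q n [set w | c n < L n w]) <=
      \int[Q n]_w step ((L n w - (c n - 2 * delta)) / delta).
    rewrite prob_gtE; apply: ler_Rintegral => // w.
    by have := step_ge (c n - 2 * delta) (L n w); rewrite subrK.
  have l2 : \int[P n]_w step ((Gam n + L n w - (c n - 2 * delta)) / delta) <=
      fine (P n [set w | c0 - gam - 4 * delta < L n w]).
    rewrite prob_gtE; apply: ler_Rintegral => // w.
    apply: le_trans (step_le _ _) _; rewrite ler_nat.
    by case: ltP => // Lw; rewrite (_ : (_ < _)%R = true)//; lra.
  lra.
have d4 : 0 <= 4 * delta by rewrite mulr_ge0// ltW.
have := cdf_near (4 * delta); rewrite (ger0_norm d4) => /(_ (lexx _)).
have := cdf_near (- (4 * delta)); rewrite normrN (ger0_norm d4) => /(_ (lexx _)).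
move: a4 a5; rewrite -!normal_cdfN.
rewrite (_ : - ((c0 - gam + 4 * delta - m) / s) =
  gam / s + u + - (4 * delta) / s); last by rewrite /c0; field; rewrite gt_eqF.
rewrite (_ : - ((c0 - gam - 4 * delta - m) / s) =
  gam / s + u + 4 * delta / s); last by rewrite /c0; field; rewrite gt_eqF.
have z33 : z = 3 * z3 by rewrite /z3; field.
rewrite z33 !ler_norml; lra.
Unshelve. all: by end_near. Qed.

End power_limit.

(** * Densities of mixtures *)

Section mixture_density.
Context d (T : measurableType d) (R : realType) (P mu : probability T R)
  (e : {i01 R}).
Hypothesis muP : mu `<< P.
Let f x := fine (density mu P x).
Let M : probability T R := mixture e P mu.

(* The density is nonnegative only almost surely; truncating it at [0] keeps
   [-e] as a lower bound everywhere. *)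
Definition centred_lr x : R := e%:num * (Num.max (f x) 0 - 1).

Let e01 : 0 <= (e%:num : R) <= 1.
Proof. by apply/andP; split. Qed.

Let EFin_f x : (f x)%:E = density mu P x.
Proof. by rewrite fineK// Radon_Nikodym_fin_num. Qed.

Let rintegrable_f : rintegrable P f.
Proof.
rewrite /rintegrable (_ : _ \o _ = density mu P); last exact/funext.
exact: Radon_Nikodym_integrable.
Qed.

Lemma measurable_fine_density : measurable_fun setT f.
Proof. exact: rintegrable_measurable rintegrable_f. Qed.
Let mf := measurable_fine_density.

Lemma measurable_centred_lr : measurable_fun setT centred_lr.
Proof.
apply: measurable_funM => //; apply: measurable_funB => //.
exact: measurable_maxr.
Qed.

Lemma centred_lr_ge x : - e%:num <= centred_lr x.
Proof.
have /andP[e0 _] := e01.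
have : 0 <= Num.max (f x) 0 by rewrite le_max lexx orbT.
by rewrite /centred_lr; nra.
Qed.

Lemma centred_lr_ae : {ae P, forall x, centred_lr x = e%:num * (f x - 1)}.
Proof.
apply: filterS (ae_eq_Radon_Nikodym_SigmaFinite muP measurableT) => x /(_ I) Ex.
have : (0 <= (f x)%:E)%E.
  by rewrite EFin_f -Ex; exact: Radon_Nikodym_SigmaFinite.f_ge0.
by rewrite lee_fin /centred_lr => /max_idPl ->.
Qed.

Lemma mixture_dominated : M `<< P.
Proof.
apply/null_content_dominatesP => A mA PA0; rewrite [LHS]mixtureE.
have -> : mu A = 0%E by move/null_content_dominatesP: muP => /(_ A mA PA0).
by rewrite PA0 !mule0 adde0.
Qed.

(** Uniqueness of densities: the convex combination of [1] and the signal density has the same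
    integral as [density M P] over every measurable set. *)
Lemma density_mixture_ae :
  {ae P, forall x, density M P x = (1 + centred_lr x)%:E}.
Proof.
pose g x := ((1 - e%:num)%:E + e%:num%:E * density mu P x)%E.
have c1 : P.-integrable setT (fun=> (1 - e%:num)%:E : \bar R).
  exact: (@rintegrable_cst _ _ _ P (1 - e%:num)).
have c2 : P.-integrable setT (fun x => e%:num%:E * density mu P x)%E.
  by apply: integrableZl => //; exact: Radon_Nikodym_integrable.
have gi : P.-integrable setT g by exact: integrableD.
have H : ae_eq P setT (density M P) g.
  apply: integral_ae_eq => //.
  - exact/Radon_Nikodym_integrable/mixture_dominated.
  - exact: measurable_int gi.
  move=> E _ mE; rewrite -Radon_Nikodym_integral//; last exact: mixture_dominated.
  rewrite integralD//; [|exact: integrableS c1|exact: integrableS c2].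
  rewrite integral_cst// integralZl//; last first.
    by apply: integrableS (Radon_Nikodym_integrable _) => //.
  by rewrite -Radon_Nikodym_integral// [LHS]mixtureE.
apply: filterS2 centred_lr_ae H => x -> /(_ I) ->.
by rewrite /g -EFin_f -EFinM -EFinD; congr (_%:E); ring.
Qed.

Lemma Rintegral_mixture (g : T -> R) : measurable_fun setT g ->
  (forall x, 0 <= g x <= 1) -> \int[M]_x g x = \int[P]_x (g x * (1 + centred_lr x)).
Proof.
move=> mg g01; apply: (congr1 fine).
have gi : M.-integrable setT (EFin \o g) by exact: integrable_itv01.
rewrite -(Radon_Nikodym_change_of_variables mixture_dominated measurableT gi).
apply: ae_eq_integral => //.
- apply: emeasurable_funM; first exact/measurable_EFinP.
  apply: measurable_int; apply: Radon_Nikodym_integrable.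
  exact: mixture_dominated.
- apply/measurable_EFinP; apply: measurable_funM => //.
  by apply: measurable_funD => //; exact: measurable_centred_lr.
by apply: filterS density_mixture_ae => x /= -> _; rewrite EFinM.
Qed.

(** Truncation at [0] only moves the density towards [1], so square integrability carries over
    pointwise. *)
Let centred_norm x : `|centred_lr x| <= `|f x - 1|.
Proof.
have /andP[e0 e1] := e01; rewrite normrM (ger0_norm e0).
apply: (@le_trans _ _ `|Num.max (f x) 0 - 1|); first by rewrite ler_piMl.
have [fx|fx] := leP (f x) 0; last by rewrite lexx.
by rewrite sub0r normrN normr1 ler0_norm; lra.
Qed.

Lemma Rintegral_density : \int[P]_x f x = 1.
Proof.
rewrite -[RHS]/(fine 1%:E) -(probability_setT mu); congr fine.
rewrite [RHS](@Radon_Nikodym_integral _ _ _ (charge_of_finite_measure mu) P setT muP)//.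
by apply: eq_integral => x _; rewrite EFin_f.
Qed.

Hypothesis f2 : rintegrable P (fun x => (f x - 1) ^+ 2).

Lemma rintegrable_centred_sqr : rintegrable P (fun x => centred_lr x ^+ 2).
Proof.
apply: rintegrable_dom f2 _.
  by apply: measurable_funX; exact: measurable_centred_lr.
move=> x; rewrite ger0_norm ?sqr_ge0//.
rewrite -(real_normK (num_real (centred_lr x))) -(real_normK (num_real (f x - 1))).
by rewrite ler_sqr ?nnegrE.
Qed.

(** The change of measure applied to the constant [1]: the mixture has total mass one. *)
Lemma Rintegral_centred_lr : \int[P]_x centred_lr x = 0.
Proof.
have ci : rintegrable P centred_lr.
  exact: rintegrable_of_sqr measurable_centred_lr rintegrable_centred_sqr.
have := @Rintegral_mixture (fun=> 1) (measurable_cst _) _.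
rewrite Rintegral_prob_cst => /(_ _)/esym.
under eq_Rintegral do rewrite mul1r.
have c1 : rintegrable P (fun=> 1) by exact: rintegrable_cst.
rewrite RintegralD// Rintegral_prob_cst => H.
apply: (addrI 1); rewrite addr0; apply: H => _.
by rewrite ler01 lexx.
Qed.

End mixture_density.

Section covariance_density.
Context d (T : measurableType d) (R : realType) (P mu nu : probability T R).
Hypotheses (muP : mu `<< P) (nuP : nu `<< P).
Let f x := fine (density mu P x).
Let g x := fine (density nu P x).

Lemma covariance_densityE :
  covariance P f g = (\int[P]_x ((f x - 1) * (g x - 1))%:E)%E.
Proof.
have Ef : fine 'E_P[f] = 1 by rewrite unlock; exact: Rintegral_density.
have Eg : fine 'E_P[g] = 1 by rewrite unlock; exact: Rintegral_density.
by rewrite unlock Ef Eg unlock.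
Qed.

End covariance_density.

(** A density has mean one, so its covariance with itself is the integral of a nonnegative square,
    and finiteness of that value is integrability. *)
Lemma rintegrable_density_sqr d (T : measurableType d) (R : realType)
    (P mu : probability T R) (f := fun x => fine (density mu P x)) :
  mu `<< P -> covariance P f f \is a fin_num ->
  rintegrable P (fun x => (f x - 1) ^+ 2).
Proof.
move=> muP; rewrite covariance_densityE// => fin.
have mf : measurable_fun setT f by exact: measurable_fine_density.
apply/integrableP; split.
  by apply/measurable_EFinP; apply: measurable_funX; exact: measurable_funB.
under eq_integral => x _.
  rewrite /= ger0_norm ?sqr_ge0// expr2; over.
by move: fin; rewrite fin_numE ltey => /andP[].
Qed.

Lemma Rintegral_centred_lrM d (T : measurableType d) (R : realType)
    (P mu nu : probability T R) (e e' : {i01 R})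
    (f := fun x => fine (density mu P x)) (g := fun x => fine (density nu P x)) :
  mu `<< P -> nu `<< P ->
  covariance P f f \is a fin_num -> covariance P g g \is a fin_num ->
  \int[P]_x (centred_lr P mu e x * centred_lr P nu e' x) =
  e%:num * e'%:num * fine (covariance P f g).
Proof.
move=> muP nuP ff gg; rewrite covariance_densityE//.
have f2 := rintegrable_density_sqr muP ff; have g2 := rintegrable_density_sqr nuP gg.
have mf : measurable_fun setT (fun x => f x - 1).
  by apply: measurable_funB => //; exact: measurable_fine_density.
have mg : measurable_fun setT (fun x => g x - 1).
  by apply: measurable_funB => //; exact: measurable_fine_density.
have fgi : rintegrable P (fun x => (f x - 1) * (g x - 1)).
  exact: (rintegrableM_of_sqr mf mg).
transitivity (\int[P]_x (e%:num * e'%:num * ((f x - 1) * (g x - 1)))); last first.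
  by rewrite RintegralZl.
apply: (congr1 fine); apply: ae_eq_integral => //.
- apply/measurable_EFinP; apply: measurable_funM; exact: measurable_centred_lr.
- by apply/measurable_EFinP; apply: measurable_funM => //; exact: measurable_funM.
apply: filterS2 (centred_lr_ae e muP) (centred_lr_ae e' nuP) => x -> -> _.
by congr (_%:E); rewrite -/(f x) -/(g x); ring.
Qed.

Lemma measure_ae_eq d (T : measurableType d) (R : realType)
    (mu : {measure set T -> \bar R}) (A B : set T) :
  measurable A -> measurable B ->
  {ae mu, forall x, A x <-> B x} -> mu A = mu B.
Proof.
move=> mA mB AB; have intE C : measurable C -> mu C = (\int[mu]_x (\1_C x)%:E)%E.
  by move=> mC; rewrite integral_indic// setIT.
rewrite !intE//; apply: ge0_ae_eq_integral => //.
- exact/measurable_EFinP/measurable_indic.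
- exact/measurable_EFinP/measurable_indic.
apply: filterS AB => x AB _; rewrite !indicE; congr ((_%:R)%:E); congr nat_of_bool.
by apply/idP/idP; rewrite !inE => /AB.
Qed.

Lemma null_dominates_ae d (T : measurableType d) (R : realType)
    (nu mu : {measure set T -> \bar R}) (A : set T) :
  nu `<< mu -> {ae mu, forall x, A x} -> {ae nu, forall x, A x}.
Proof.
move=> /null_content_dominatesP numu [N [mN N0 AN]]; exists N; split => //.
exact: numu.
Qed.

(** * Signal detection models *)

Lemma cvg_near_eq (R : realType) (f g : nat -> R) (l : R) :
  (\forall n \near \oo, f n = g n) ->
  f n @[n --> \oo] --> l -> g n @[n --> \oo] --> l.
Proof. by move=> fg; apply: cvg_trans; exact: near_eq_cvg. Qed.

Lemma ae_imply d (T : measurableType d) (R : realType)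
    (mu : {measure set T -> \bar R}) (A B : set T) :
  {ae mu, forall x, A x} -> (forall x, A x -> B x) -> {ae mu, forall x, B x}.
Proof. by move=> Aae AB; apply: filterS Aae. Qed.

Section detection_limits.
Context (R : realType) (k : nat -> nat)
  (d : forall n, 'I_(k n) -> measure_display).
Arguments d : clear implicits.
Context (X : forall n (i : 'I_(k n)), measurableType (d n i)).
Arguments X : clear implicits.
Context (P : forall n (i : 'I_(k n)), probability (X n i) R).
Arguments P : clear implicits.
Implicit Types theta : signal_model P.

Definition model_lr theta n i : X n i -> R :=
  centred_lr (P n i) (signal theta n i) (strength theta n i).

Arguments model_lr : clear implicits.

Definition max_strength theta n : R :=
  \big[Num.max/0]_(i < k n) (strength theta n i)%:num.

Lemma max_strength_ge0 theta n : 0 <= max_strength theta n.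
Proof. exact: bigmax_ge_id. Qed.

Lemma model_lr_ge theta n i x : - max_strength theta n <= model_lr theta n i x.
Proof.
apply: le_trans (centred_lr_ge _ _ _ x); rewrite lerN2.
exact: (le_bigmax 0 (fun i => (strength theta n i)%:num)).
Qed.

Lemma measurable_model_lr theta n i : measurable_fun setT (model_lr theta n i).
Proof. by apply: measurable_centred_lr; exact: signal_dominated. Qed.

Lemma coord_law_dominated theta n i : coord_law theta n i `<< P n i.
Proof. by apply: mixture_dominated; exact: signal_dominated. Qed.

Lemma measurable_loglik theta n : measurable_fun setT (loglik theta n).
Proof.
apply: emeasurable_sum => i.
apply: (measurableT_comp (f := fun x => lne (density (coord_law theta n i) (P n i) x)));
  last exact: measurable_coord.
have dom := @coord_law_dominated theta n i.
have mD := measurable_fine_density dom.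
set D := fun x => fine _ in mD.
rewrite (_ : (fun _ => _) = fun x => if D x <= 0 then -oo%E else (ln (D x))%:E).
  apply: measurable_fun_ifT => //; first exact: measurable_fun_ler.
  by apply/measurable_EFinP; exact: (measurableT_comp (@measurable_ln R)).
apply/funext => x; rewrite -[density _ _ x]fineK// Radon_Nikodym_fin_num//.
Qed.

(** A maximal strength below one keeps every factor [1 + B_i] positive, so no [lne] is infinite.
    Domination transfers the null sets of the noise to [p], which covers both the noise and the
    alternatives. *)
Lemma loglik_ae theta n (p : forall i, probability (X n i) R) :
  (forall i, p i `<< P n i) -> max_strength theta n < 1 ->
  {ae product_probability p, forall y,
    loglik theta n y = (log_lr (model_lr theta n) y)%:E}.
Proof.
move=> dom e1.
have H i : {ae p i, forall x, density (coord_law theta n i) (P n i) x =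
    (1 + model_lr theta n i x)%:E}.
  apply: null_dominates_ae (dom i) _; apply: density_mixture_ae.
  exact: signal_dominated.
apply: (ae_imply (ae_product_probability H)) => y Hy.
rewrite /loglik /log_lr -sumEFin; apply: eq_bigr => i _; rewrite Hy lne_EFin//.
by have := model_lr_ge theta (y i); move: e1; move: (max_strength _ _) => *; lra.
Qed.

Lemma prob_loglik theta n (p : forall i, probability (X n i) R) x :
  (forall i, p i `<< P n i) -> max_strength theta n < 1 ->
  product_probability p [set y | (x%:E < loglik theta n y)%E] =
  product_probability p [set y | x < log_lr (model_lr theta n) y].
Proof.
move=> dom e1.
have mL : measurable_fun setT (log_lr (model_lr theta n)).
  by apply: measurable_log_lr => i; exact: measurable_model_lr.
apply: measure_ae_eq.
- rewrite (_ : [set y | _] = loglik theta n @^-1` `]x%:E, +oo%E]); last first.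
    by apply/seteqP; split => y /=; rewrite in_itv/= ?leey ?andbT// => /andP[].
  rewrite -[X in measurable X]setTI.
  by apply: measurable_loglik => //; exact: emeasurable_itv.
- rewrite (_ : [set y | _] = log_lr (model_lr theta n) @^-1` `]x, +oo[).
    rewrite -[X in measurable X]setTI.
    exact: mL.
  by apply/seteqP; split => y /=; rewrite in_itv/= andbT.
- by apply: (ae_imply (loglik_ae dom e1)) => y /= ->; rewrite lte_fin.
Qed.

Lemma near_max_strength theta e : 0 < e ->
  \forall n \near \oo, max_strength theta n <= e.
Proof.
move=> e0; near=> n.
have : `|max_strength theta n - 0| <= e.
  by near: n; exact: near_dist_le (strength_cvg0 theta) e0.
by rewrite subr0 ger0_norm ?max_strength_ge0.
Unshelve. all: by end_near. Qed.

Lemma expectation_lr_test theta n (p : forall i, probability (X n i) R) c :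
  (forall i, p i `<< P n i) -> max_strength theta n < 1 ->
  ('E_(product_probability p)[lr_test theta c n])%E =
  (fine (product_probability p [set y | c n < log_lr (model_lr theta n) y]))%:E.
Proof.
move=> dom e1.
have mL : measurable_fun setT (log_lr (model_lr theta n)).
  by apply: measurable_log_lr => i; exact: measurable_model_lr.
rewrite fineK ?fin_num_measure//; last first.
  rewrite (_ : [set y | _] = log_lr (model_lr theta n) @^-1` `]c n, +oo[).
    rewrite -[X in measurable X]setTI.
    exact: mL.
  by apply/seteqP; split => y /=; rewrite in_itv/= andbT.
rewrite -prob_loglik// unlock /lr_test integral_indic// ?setIT//.
rewrite (_ : [set y | _] = loglik theta n @^-1` `](c n)%:E, +oo%E]); last first.
  by apply/seteqP; split => y /=; rewrite in_itv/= ?leey ?andbT// => /andP[].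
rewrite -[X in measurable X]setTI.
by apply: measurable_loglik => //; exact: emeasurable_itv.
Qed.

Lemma tail_cvg theta m s x : 0 < s ->
  cvg_in_distribution (noise_law P) (loglik theta) (normal_prob m s) ->
  fine (noise_law P n [set y | x < log_lr (model_lr theta n) y])
    @[n --> \oo] --> 1 - normal_cdf ((x - m) / s).
Proof.
move=> s0 cvgL.
(* Every point is a continuity point of the normal law, so the convergence may be used at each
   [x]. *)
have cont : {for x, continuous (fun t => normal_prob m s `]-oo, t]%classic)}.
  rewrite (_ : (fun t => _) = fun t => (normal_cdf ((t - m) / s))%:E); last first.
    by apply/funext => t; rewrite normal_prob_cdf.
  apply: cvg_EFin; first exact: nearW.
  apply: (cvg_comp (fun t : R => (t - m) / s) (@normal_cdf R)); last first.
    exact: normal_cdf_continuous.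
  apply: cvgM; last exact: cvg_cst.
  by apply: cvgB; [exact: cvg_id|exact: cvg_cst].
have : noise_law P n [set y | (loglik theta n y <= x%:E)%E] @[n --> \oo] -->
    (normal_cdf ((x - m) / s))%:E.
  by rewrite -(normal_prob_cdf m x s0); exact: cvgL.
move=> /fine_cvg cvgx.
have {}cvgx : 1 - fine (noise_law P n [set y | (loglik theta n y <= x%:E)%E])
    @[n --> \oo] --> 1 - normal_cdf ((x - m) / s).
  by apply: cvgB cvgx; exact: cvg_cst.
apply: cvg_near_eq cvgx; near=> n.
have e1 : max_strength theta n < 1.
  apply: (@le_lt_trans _ _ (1 / 2)); last by lra.
  by near: n; apply: near_max_strength; rewrite divr_gt0.
have <- : noise_law P n [set y | (x%:E < loglik theta n y)%E] =
    noise_law P n [set y | x < log_lr (model_lr theta n) y].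
  by apply: prob_loglik => // i.
have mA : measurable [set y | (loglik theta n y <= x%:E)%E].
  rewrite (_ : [set y | _] = loglik theta n @^-1` `[-oo%E, x%:E]); last first.
    by apply/seteqP; split => y /=; rewrite in_itv/= ?leNye// => /andP[].
  rewrite -[X in measurable X]setTI.
  by apply: measurable_loglik => //; exact: emeasurable_itv.
rewrite (_ : [set y | (x%:E < _)%E] = ~` [set y | (loglik theta n y <= x%:E)%E]).
  by rewrite probability_setC// fineB// fin_num_measure.
apply/seteqP; split => y /=; first by rewrite ltNge => /negP.
by rewrite ltNge => /negP.
Unshelve. all: by end_near. Qed.

End detection_limits.
Arguments model_lr {R k d X P} theta n i x.

Section detection_power.
Context (R : realType) (k : nat -> nat)
  (d : forall n, 'I_(k n) -> measure_display).
Arguments d : clear implicits.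
Context (X : forall n (i : 'I_(k n)), measurableType (d n i)).
Arguments X : clear implicits.
Context (P : forall n (i : 'I_(k n)), probability (X n i) R).
Arguments P : clear implicits.
Variables (theta theta' : signal_model P).
Hypotheses (fin : forall n i, signal_cov theta theta n i \is a fin_num)
  (fin' : forall n i, signal_cov theta' theta' n i \is a fin_num).

Let A n i := model_lr theta n i.
Let B n i := model_lr theta' n i.
Arguments A : clear implicits.
Arguments B : clear implicits.

Let mA n i : measurable_fun setT (A n i).
Proof. exact: measurable_model_lr. Qed.

Let mB n i : measurable_fun setT (B n i).
Proof. exact: measurable_model_lr. Qed.

Let A2 n i : rintegrable (P n i) (fun x => A n i x ^+ 2).
Proof.
apply: rintegrable_centred_sqr; first exact: signal_dominated.
by apply: rintegrable_density_sqr; [exact: signal_dominated|exact: fin].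
Qed.

Let B2 n i : rintegrable (P n i) (fun x => B n i x ^+ 2).
Proof.
apply: rintegrable_centred_sqr; first exact: signal_dominated.
by apply: rintegrable_density_sqr; [exact: signal_dominated|exact: fin'].
Qed.

Let cov_sum_AB n : cov_sum theta theta' n = cov_AB (P n) (A n) (B n).
Proof.
apply: eq_bigr => i _; apply/esym.
by apply: Rintegral_centred_lrM; [exact: signal_dominated..|exact: fin|exact: fin'].
Qed.

Let cov_sum_AA n : cov_sum theta theta n = \sum_(i < k n) \int[P n i]_x A n i x ^+ 2.
Proof.
apply: eq_bigr => i _; apply/esym.
rewrite -[RHS]Rintegral_centred_lrM; [|exact: signal_dominated..|exact: fin|exact: fin].
by apply: eq_Rintegral => x _; rewrite expr2.
Qed.

Let cov_sum_BB n : cov_sum theta' theta' n = \sum_(i < k n) \int[P n i]_x B n i x ^+ 2.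
Proof.
apply: eq_bigr => i _; apply/esym.
rewrite -[RHS]Rintegral_centred_lrM; [|exact: signal_dominated..|exact: fin'|exact: fin'].
by apply: eq_Rintegral => x _; rewrite expr2.
Qed.

(** The sum of the second moments of [A_i + t B_i]. In the limit it yields the Cauchy-Schwarz
    inequality for [gamma], hence the bound on [ARE]. *)
Lemma cov_sum_quadratic_ge0 t n :
  0 <= cov_sum theta theta n + 2 * t * cov_sum theta theta' n
       + t ^+ 2 * cov_sum theta' theta' n.
Proof.
rewrite cov_sum_AA cov_sum_AB cov_sum_BB !mulr_sumr -!big_split/=.
apply: sumr_ge0 => i _.
have A2i := A2 i; have B2i := B2 i.
have ABi : rintegrable (P n i) (fun x => A n i x * B n i x).
  exact: rintegrableM_of_sqr.
have i1 := rintegrableZ (2 * t) ABi; have i2 := rintegrableZ (t ^+ 2) B2i.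
rewrite -!RintegralZl// -RintegralD// -RintegralD//; last exact: rintegrableD.
apply: Rintegral_ge0 => x _.
rewrite (_ : _ + _ = (A n i x + t * B n i x) ^+ 2) ?sqr_ge0//; ring.
Qed.

Lemma detection_power (c : nat -> R) (v s gam u : R) :
  0 < s ->
  cvg_in_distribution (noise_law P) (loglik theta')
    (normal_prob (- (s ^+ 2 / 2)) s) ->
  cov_sum theta theta n @[n --> \oo] --> v ->
  cov_sum theta theta' n @[n --> \oo] --> gam ->
  cov_sum theta' theta' n @[n --> \oo] --> s ^+ 2 ->
  ('E_(noise_law P n)[lr_test theta' c n])%E @[n --> \oo] --> (normal_cdf u)%:E ->
  ('E_(model_law theta n)[lr_test theta' c n])%E @[n --> \oo] -->
    (normal_cdf (gam / s + u))%:E.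
Proof.
move=> s0 Ncvg vcvg gcvg scvg level.
pose L n := log_lr (B n).
have EA n i : \int[P n i]_x A n i x = 0.
  apply: Rintegral_centred_lr; first exact: signal_dominated.
  by apply: rintegrable_density_sqr; [exact: signal_dominated|exact: fin].
have EB n i : \int[P n i]_x B n i x = 0.
  apply: Rintegral_centred_lr; first exact: signal_dominated.
  by apply: rintegrable_density_sqr; [exact: signal_dominated|exact: fin'].
have QP n i (f : X n i -> R) : measurable_fun setT f -> (forall x, 0 <= f x <= 1) ->
    \int[coord_law theta n i]_x f x = \int[P n i]_x (f x * (1 + A n i x)).
  by apply: Rintegral_mixture; exact: signal_dominated.
have h2 : 0 < (1 / 2 : R) by rewrite divr_gt0.
have small : \forall n \near \oo, max_strength theta' n <= 1 / 2.
  exact: near_max_strength.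
have lt1 n : max_strength theta' n <= 1 / 2 -> max_strength theta' n < 1.
  by move=> e12; apply: (le_lt_trans e12); lra.
have B12 n : max_strength theta' n <= 1 / 2 -> forall i x, - (1 / 2) <= B n i x.
  by move=> e12 i x; apply: le_trans (model_lr_ge theta' x); rewrite lerN2.
have Lcvg x : fine (noise_law P n [set y | x < L n y]) @[n --> \oo] -->
    1 - normal_cdf ((x - - (s ^+ 2 / 2)) / s).
  exact: tail_cvg.
have tail0 eta : 0 < eta ->
    tail_sum (P n) (B n) eta @[n --> \oo] --> 0.
  move=> eta0; apply: (@tail_sum_cvg0 _ s eta
    (fun n => \sum_(i < k n) \int[P n i]_x B n i x ^+ 2) (max_strength theta') _
    (fun n x => fine (noise_law P n [set y | x < L n y]))) => //.
  - by under eq_cvg do rewrite -cov_sum_BB.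
  - exact: strength_cvg0.
  - by move=> n; exact: max_strength_ge0.
  - move=> n; apply: sumr_ge0 => i _; apply: Rintegral_ge0 => x _.
    exact: tail_sqr_ge0.
  - by move=> x; have := Lcvg x; rewrite opprK.
  near=> n => delta K d0.
  have e12 : max_strength theta' n <= 1 / 2 by near: n.
  apply: hellinger_tail_bound => //.
  - exact: B12.
  - by rewrite max_strength_ge0.
  - by move=> i x; exact: model_lr_ge.
have power : fine (model_law theta n [set y | c n < L n y]) @[n --> \oo] -->
    normal_cdf (gam / s + u).
  apply: (@power_cvg _ _ _ (noise_law P) (model_law theta) L
    (fun n => cov_AB (P n) (A n) (B n)) c gam (- (s ^+ 2 / 2)) s u) => //.
  - by move=> n; exact: measurable_log_lr.
  - by under eq_cvg do rewrite -cov_sum_AB.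
  (* Eventually each of the two sums of second moments is within [1] of its limit, whence the
     summand [2]. *)
  - move=> C zeta C0 zeta0; pose S := `|v| + s ^+ 2 + 2.
    have S0 : 0 < S by rewrite ltr_wpDl// addr_ge0// sqr_ge0.
    pose K := 6 * C * (S + 1) + 2 * C * S * (S + 2).
    have K0 : 0 < K.
      by rewrite addr_gt0// !mulr_gt0// addr_gt0.
    (* Half of [zeta] pays for [eta], the other half for [tail_sum / eta], which is at most [eta]
       once the tail sum is below [eta ^+ 2]. *)
    pose eta := zeta / (2 * K).
    have eta0 : 0 < eta by rewrite divr_gt0// mulr_gt0.
    near=> n => h h' hh.
    have e12 : max_strength theta' n <= 1 / 2 by near: n.
    have ee : max_strength theta' n <= eta by near: n; exact: near_max_strength.
    have v1 : `|cov_sum theta theta n - v| <= 1 by near: n; exact: near_dist_le.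
    have s1 : `|cov_sum theta' theta' n - s ^+ 2| <= 1.
      by near: n; exact: near_dist_le.
    have t1 : `|tail_sum (P n) (B n) eta - 0| <= eta ^+ 2.
      by near: n; apply: near_dist_le; [exact: tail0|exact: exprn_gt0].
    have SS : \sum_(i < k n) (\int[P n i]_x A n i x ^+ 2 + \int[P n i]_x B n i x ^+ 2) <= S.
      rewrite big_split/= -cov_sum_AA -cov_sum_BB.
      by move: v1 s1 (ler_norm v); rewrite !ler_norml /S; lra.
    have Beta i x : - eta <= B n i x.
      by apply: le_trans (model_lr_ge theta' x); rewrite lerN2.
    apply: (le_trans (product_model_swap (@mA n) (@mB n) (@A2 n) (@B2 n) (@EA n)
      (B12 n e12) (@QP n) eta0 C0 hh Beta SS)).
    rewrite -/K (_ : zeta = K * (eta + eta)); last first.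
      by rewrite /eta; field; rewrite gt_eqF.
    rewrite ler_wpM2l ?(ltW K0)// lerD2l ler_pdivrMr// -expr2.
    by move: t1; rewrite subr0; apply: le_trans; exact: ler_norm.
  - move/fine_cvg: level; apply: cvg_near_eq; near=> n.
    have e12 : max_strength theta' n <= 1 / 2 by near: n.
    by rewrite /= expectation_lr_test// ?lt1// => i.
apply: cvg_EFin.
  near=> n; have e12 : max_strength theta' n <= 1 / 2 by near: n.
  rewrite expectation_lr_test// ?lt1// => i; exact: coord_law_dominated.
apply: cvg_near_eq power; near=> n.
have e12 : max_strength theta' n <= 1 / 2 by near: n.
by rewrite /= expectation_lr_test// ?lt1// => i; exact: coord_law_dominated.
Unshelve. all: by end_near. Qed.

End detection_power.

Theorem theorem2p6 (R : realType) (k : nat -> nat)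
    (d : forall n, 'I_(k n) -> measure_display)
    (X : forall n (i : 'I_(k n)), measurableType (d n i))
    (P : forall n (i : 'I_(k n)), probability (X n i) R)
    (theta : 'I_2 -> signal_model P)
    (sigma : 'I_2 -> R) (gamma : 'I_2 -> 'I_2 -> R)
    (alpha u_alpha : R) (c : 'I_2 -> nat -> R) :
  k n @[n --> \oo] --> \oo ->
  (forall j, 0 < sigma j) ->
  (forall j, cvg_in_distribution (noise_law P) (loglik (theta j))
     (normal_prob (- (sigma j ^+ 2 / 2)) (sigma j))) ->
  (forall j, cvg_in_distribution (model_law (theta j)) (loglik (theta j))
     (normal_prob (sigma j ^+ 2 / 2) (sigma j))) ->
  (forall j r n i, signal_cov (theta j) (theta r) n i \is a fin_num) ->
  (forall j r, cov_sum (theta j) (theta r) n @[n --> \oo] --> gamma j r) ->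
  (forall j, gamma j j = sigma j ^+ 2) ->
  0 < alpha < 1 ->
  normal_cdf u_alpha = alpha ->
  (forall j, ('E_(noise_law P n)[lr_test (theta j) (c j) n])%E
     @[n --> \oo] --> alpha%:E) ->
  [/\ ('E_(model_law (theta ord0) n)[lr_test (theta ord_max) (c ord_max) n])%E
        @[n --> \oo] -->
      (normal_cdf (gamma ord0 ord_max / Num.sqrt (gamma ord_max ord_max)
                   + u_alpha))%:E,
      normal_cdf (gamma ord0 ord_max / Num.sqrt (gamma ord_max ord_max)
                  + u_alpha) =
      normal_cdf (Num.sg (gamma ord0 ord_max)
                  * Num.sqrt (gamma ord0 ord0 * ARE gamma) + u_alpha) &
      0 <= ARE gamma <= 1].
Proof.
move=> _ sigma0 Ncvg _ fin cov_cvg gamma_diag alpha01 u_alphaE level.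
set s0 := sigma ord0; set s1 := sigma ord_max; set g := gamma ord0 ord_max.
have s00 : 0 < s0 by exact: sigma0.
have s10 : 0 < s1 by exact: sigma0.
have g0E : gamma ord0 ord0 = s0 ^+ 2 by exact: gamma_diag.
have g1E : gamma ord_max ord_max = s1 ^+ 2 by exact: gamma_diag.
have sqrt_g1 : Num.sqrt (gamma ord_max ord_max) = s1.
  by rewrite g1E sqrtr_sqr gtr0_norm.
split.
- rewrite sqrt_g1.
  apply: (detection_power (fin ord0 ord0) (fin ord_max ord_max) s10 (Ncvg ord_max)
    (cov_cvg ord0 ord0) (cov_cvg ord0 ord_max)).
  + by rewrite -g1E; exact: cov_cvg.
  + by rewrite u_alphaE.
- rewrite sqrt_g1 /ARE g0E g1E -/g; congr (normal_cdf (_ + _)).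
  have -> : s0 ^+ 2 * (g ^+ 2 / (s0 ^+ 2 * s1 ^+ 2)) = (g / s1) ^+ 2.
    by field; rewrite !gt_eqF.
  (* The square root is [|g| / s1], and multiplying by the sign of [g] restores [g / s1], also for
     [g = 0]. *)
  by rewrite sqrtr_sqr normrM mulrA -numEsg (gtr0_norm (x := s1^-1)) ?invr_gt0.
have d0 : 0 < s0 ^+ 2 * s1 ^+ 2 by rewrite mulr_gt0// exprn_gt0.
rewrite /ARE g0E g1E -/g divr_ge0 ?sqr_ge0 ?(ltW d0)//= ler_pdivrMr// mul1r.
(* The minimizer of the limiting quadratic in [t]; its minimal value [s0^2 - g^2 / s1^2] is
   nonnegative exactly when [ARE] is at most one. *)
pose t := - (g / s1 ^+ 2).
have lim : cov_sum (theta ord0) (theta ord0) n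
    + 2 * t * cov_sum (theta ord0) (theta ord_max) n
    + t ^+ 2 * cov_sum (theta ord_max) (theta ord_max) n @[n --> \oo] -->
    gamma ord0 ord0 + 2 * t * g + t ^+ 2 * gamma ord_max ord_max.
  apply: cvgD; first apply: cvgD; first exact: cov_cvg.
  - by apply: cvgM; [exact: cvg_cst|exact: cov_cvg].
  - by apply: cvgM; [exact: cvg_cst|exact: cov_cvg].
have : 0 <= gamma ord0 ord0 + 2 * t * g + t ^+ 2 * gamma ord_max ord_max.
  (* A negative limit would force negative terms: at distance at most half its modulus, they could
     not be sums of squares. *)
  rewrite leNgt; apply/negP => neg.
  have := @near_dist_le _ _ _ (- (gamma ord0 ord0 + 2 * t * g
    + t ^+ 2 * gamma ord_max ord_max) / 2) lim.
  rewrite divr_gt0 ?oppr_gt0// => /(_ isT)[N _ /(_ N (leqnn N))] /=.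
  have := cov_sum_quadratic_ge0 (fin ord0 ord0) (fin ord_max ord_max) t N.
  move: neg; rewrite ler_norml; lra.
rewrite g0E g1E.
have -> : s0 ^+ 2 + 2 * t * g + t ^+ 2 * s1 ^+ 2 = s0 ^+ 2 - g ^+ 2 / s1 ^+ 2.
  by rewrite /t; field; rewrite gt_eqF.
by rewrite subr_ge0 ler_pdivrMr// exprn_gt0.
Qed.
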